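(* Each of the 16 types of sequences (1)--(16) is an Auslander-Reiten sequence in $\mathrm{rep}_k(A_{\mathbb R})$.
   Context: Fix a field $k$. A quiver of continuous type $A$ is a triple $A_{\mathbb R}=(\mathbb R,S,\preceq)$: $S\subset\mathbb R$ is a discrete (possibly empty) subset without accumulation points; $\bar S=S\cup\{\pm\infty\}$ with $-\infty<s<+\infty$ for $s\in S$; the elements of $\bar S$ are indexed in increasing order by a convex subset of $\mathbb Z\cup\{\pm\infty\}$ containing $0$, $s_n$ being the element of index $n$; $\preceq$ is the partial order on $\mathbb R$ for which two points are comparable only if they lie in a common closed interval between consecutive elements of $\bar S$, on each such interval $\preceq$ is $\le$ or its reverse, the direction reverses at each element of $S$, and $s_n$ is a sink ($\preceq$-minimal) if $n$ is even and a source ($\preceq$-maximal) if $n$ is odd. (An infinite $s_n$ with $n\in\mathbb Z$ is also called a sink or source according to the parity of $n$.) A representation $V$ assigns a $k$-vector space $V(x)$ to each $x\in\mathbb R$ and a linear map $V(x,y):V(x)\to V(y)$ to each $y\preceq x$, with $V(x,z)=V(y,z)\circ V(x,y)$ for $z\preceq y\preceq x$. For an interval $I$, $M_I$ is the representation with $M_I(x)=k$ for $x\in I$ and $0$ otherwise, and identity maps between comparable points of $I$; a bracket at an infinite endpoint is read as open. The indecomposable projectives are the interval representations with supports $\{x\preceq a\}$, $\{x\preceq a,\ x<a\}$, $\{x\preceq a,\ x>a\}$ (when nonempty; also $P_{\pm\infty}$ when $\pm\infty$ is a source with finite index, with support the interval between $\pm\infty$ and the adjacent sink, sink included if finite). $\mathrm{rep}_k(A_{\mathbb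 R})$ is the category of pointwise finite-dimensional representations that are quotients of finite direct sums of indecomposable projectives. It is abelian and Krull-Schmidt, and its indecomposables are, up to isomorphism, representations $M_I$. A short exact sequence $0\to N\xrightarrow{f}E\xrightarrow{g}M\to0$ is an Auslander-Reiten (almost split) sequence if $f$ is not a section, $g$ is not a retraction, $N$ and $M$ are indecomposable, every nontrivial morphism $N\to X$ with $X$ indecomposable, $X\not\cong N$, factors through $f$, and every nontrivial morphism $X\to M$ with $X$ indecomposable, $X\not\cong M$, factors through $g$. The 16 types. For $a\in\mathbb R\setminus S$ let $s_a$ denote the sink among the two consecutive elements of $\bar S$ surrounding $a$. In each type the monomorphism is $\begin{bmatrix}1\\1\end{bmatrix}$ and the epimorphism is $\begin{bmatrix}1&-1\end{bmatrix}$. Types (1)--(4), $a<b$, $a,b\notin\bar S$: (1) $s_a<a,\ s_b<b$: $M_{[a,b)}\hookrightarrow M_{[a,b]}\oplus M_{(a,b)}\twoheadrightarrow M_{(a,b]}$; (2) $s_a<a,\ s_b>b$: $M_{[a,b]}\hookrightarrow M_{[a,b)}\oplus M_{(a,b]}\twoheadrightarrow M_{(a,b)}$; (3) $s_a>a,\ s_b<b$: $M_{(a,b)}\hookrightarrow M_{(a,b]}\oplus M_{[a,b)}\twoheadrightarrow M_{[a,b]}$; (4) $s_a>a,\ s_b>b$: $M_{(a,b]}\hookrightarrow M_{(a,b)}\oplus M_{[a,b]}\twoheadrightarrow M_{[a,b)}$. Types (5),(6), $s_{2n-1}<s_{2n}<b$, $b\notin \bar S$: (5) $s_b<b$: $M_{[s_{2n-1},b)}\hookrightarrow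 M_{[s_{2n-1},b]}\oplus M_{(s_{2n},b)}\twoheadrightarrow M_{(s_{2n},b]}$; (6) $s_b>b$: $M_{[s_{2n-1},b]}\hookrightarrow M_{[s_{2n-1},b)}\oplus M_{(s_{2n},b]}\twoheadrightarrow M_{(s_{2n},b)}$. Types (7),(8), $s_{2n}<s_{2n+1}<b$, $b\notin\bar S$: (7) $s_b<b$: $M_{(s_{2n+1},b)}\hookrightarrow M_{(s_{2n+1},b]}\oplus M_{[s_{2n},b)}\twoheadrightarrow M_{[s_{2n},b]}$; (8) $s_b>b$: $M_{(s_{2n+1},b]}\hookrightarrow M_{(s_{2n+1},b)}\oplus M_{[s_{2n},b]}\twoheadrightarrow M_{[s_{2n},b)}$. Types (9),(10), $a<s_{2n}<s_{2n+1}$, $a\notin\bar S$: (9) $s_a<a$: $M_{[a,s_{2n+1}]}\hookrightarrow M_{[a,s_{2n})}\oplus M_{(a,s_{2n+1}]}\twoheadrightarrow M_{(a,s_{2n})}$; (10) $s_a>a$: $M_{(a,s_{2n+1}]}\hookrightarrow M_{(a,s_{2n})}\oplus M_{[a,s_{2n+1}]}\twoheadrightarrow M_{[a,s_{2n})}$. Types (11),(12), $a<s_{2n-1}<s_{2n}$, $a\notin\bar S$: (11) $s_a<a$: $M_{[a,s_{2n-1})}\hookrightarrow M_{[a,s_{2n}]}\oplus M_{(a,s_{2n-1})}\twoheadrightarrow M_{(a,s_{2n}]}$; (12) $s_a>a$: $M_{(a,s_{2n-1})}\hookrightarrow M_{(a,s_{2n}]}\oplus M_{[a,s_{2n-1})}\twoheadrightarrow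 M_{[a,s_{2n}]}$. Types (13)--(16): (13) $s_{2m}<s_{2m+1}<s_{2n}<s_{2n+1}$: $M_{(s_{2m+1},s_{2n+1}]}\hookrightarrow M_{(s_{2m+1},s_{2n})}\oplus M_{[s_{2m},s_{2n+1}]}\twoheadrightarrow M_{[s_{2m},s_{2n})}$; (14) $s_{2m-1}<s_{2m}<s_{2n}<s_{2n+1}$: $M_{[s_{2m-1},s_{2n+1}]}\hookrightarrow M_{[s_{2m-1},s_{2n})}\oplus M_{(s_{2m},s_{2n+1}]}\twoheadrightarrow M_{(s_{2m},s_{2n})}$; (15) $s_{2m}<s_{2m+1}<s_{2n-1}<s_{2n}$: $M_{(s_{2m+1},s_{2n-1})}\hookrightarrow M_{(s_{2m+1},s_{2n}]}\oplus M_{[s_{2m},s_{2n-1})}\twoheadrightarrow M_{[s_{2m},s_{2n}]}$; (16) $s_{2m-1}<s_{2m}<s_{2n-1}<s_{2n}$: $M_{[s_{2m-1},s_{2n-1})}\hookrightarrow M_{[s_{2m-1},s_{2n}]}\oplus M_{(s_{2m},s_{2n-1})}\twoheadrightarrow M_{(s_{2m},s_{2n}]}$. *)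

(* Defs.v *)
From HB Require Import structures.
From mathcomp Require Import all_boot all_order all_algebra.
From mathcomp Require Import all_classical all_reals all_analysis.
Set Implicit Arguments.
Unset Strict Implicit.
Unset Printing Implicit Defensive.
Import Order.TTheory GRing.Theory Num.Theory.
Import numFieldNormedType.Exports.
Local Open Scope classical_set_scope.
Local Open Scope ring_scope.

(** The index set is a subset of [\bar int], i.e. of Z with both infinities.
    The values of [cq_elt] outside [cq_idx] are irrelevant.  A subset of R
    without accumulation points is automatically discrete. *)
Record cquiver (R : realType) := CQuiver {
  cq_S : set R;
  cq_S_noacc : limit_point cq_S = set0;
  cq_idx : set (\bar int);
  cq_elt : \bar int -> \bar R;
  cq_idx0 : cq_idx 0%:E;
  cq_idx_convex : forall m n p : \bar int,
    cq_idx m -> cq_idx n -> (m <= p)%E -> (p <= n)%E -> cq_idx p;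
  cq_elt_incr : forall m n : \bar int,
    cq_idx m -> cq_idx n -> (m < n)%E -> (cq_elt m < cq_elt n)%E;
  cq_elt_image :
    cq_elt @` cq_idx = (@EFin R) @` cq_S `|` [set -oo%E; +oo%E] }.

Definition evenz (n : int) : bool := (2 %| n)%Z.

Section Quiver.
Context {R : realType} (A : cquiver R).

Definition hasidx (n : int) : Prop := cq_idx A n%:E.

Definition vtx (n : int) : \bar R := cq_elt A n%:E.

(** [prec x y] is x ≼ y.  The index set being convex, the pairs of consecutive
    elements of S ∪ {±oo} are exactly the (s_n, s_(n+1)) with n and n+1 finite
    indices.  On [s_n, s_(n+1)] the order is <= if the sink of the pair is s_n
    (n even), and >= if it is s_(n+1) (n odd). *)
Definition prec (x y : R) : Prop :=
  exists n : int,
    [/\ hasidx n, hasidx (n + 1),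
        x%:E \in `[vtx n, vtx (n + 1)], y%:E \in `[vtx n, vtx (n + 1)]
      & if evenz n then x <= y else y <= x].

(** For a not in S: t is the sink s_a among the two consecutive elements of
    S ∪ {±oo} surrounding a. *)
Definition surrounding_sink (a : R) (t : \bar R) : Prop :=
  exists n : int,
    [/\ hasidx n, hasidx (n + 1), (vtx n < a%:E)%E, (a%:E < vtx (n + 1))%E
      & t = if evenz n then vtx n else vtx (n + 1)].

Lemma vtx_ltn m n : hasidx m -> hasidx n -> m < n -> (vtx m < vtx n)%E.
Proof. by move=> im jn mn; apply: cq_elt_incr => //; rewrite lte_fin. Qed.

Lemma vtx_leq m n : hasidx m -> hasidx n -> m <= n -> (vtx m <= vtx n)%E.
Proof.
move=> im jn; rewrite le_eqVlt => /orP[/eqP->//|mn].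
by apply: ltW; apply: vtx_ltn.
Qed.

Lemma prec_between x y z :
  prec y x -> prec z y -> (z <= y <= x) || (x <= y <= z).
Proof.
move=> [n [n0 n1]]; rewrite !itv_boundlr /= !bnd_simp.
move=> /andP[ny yn] /andP[nx xn] yx [m [m0 m1]].
rewrite !itv_boundlr /= !bnd_simp => /andP[mz zm] /andP[my ym] zy.
have [mn|nm|mn] := ltgtP m n.
- have e : y%:E = vtx n.
    apply/le_anti; rewrite ny (le_trans ym)//.
    by apply: vtx_leq => //; rewrite -ltzD1 ltrD2r.
  have yx' : y <= x by rewrite -lee_fin e.
  have zy' : z <= y by rewrite -lee_fin e (le_trans zm)// vtx_leq// -ltzD1 ltrD2r.
  by rewrite zy' yx'.
- have e : y%:E = vtx (n + 1).
    apply/le_anti; rewrite yn (le_trans _ my)//.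
    by apply: vtx_leq => //; rewrite -ltzD1 ltrD2r.
  have yx' : x <= y by rewrite -lee_fin e.
  have zy' : y <= z by rewrite -lee_fin e (le_trans _ mz)// vtx_leq// -ltzD1 ltrD2r.
  by rewrite zy' yx' orbT.
- move: zy yx; rewrite mn; case: ifP => _ -> -> //; by rewrite orbT.
Qed.

End Quiver.

Section Representations.
Context {R : realType} (k : fieldType) (A : cquiver R).

Record rep := Rep {
  rep_sp :> R -> lmodType k;
  rep_map : forall x y : R, prec A y x -> {linear rep_sp x -> rep_sp y};
  rep_map_id : forall (x : R) (h : prec A x x) (v : rep_sp x),
    rep_map h v = v;
  rep_map_comp : forall (x y z : R) (hyx : prec A y x) (hzy : prec A z y)
      (hzx : prec A z x) (v : rep_sp x),
    rep_map hzx v = rep_map hzy (rep_map hyx v) }.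

(** A morphism of representations is an [f : fam V W] such that [natural f]. *)
Definition fam (V W : rep) : Type := forall x : R, {linear V x -> W x}.

Definition natural (V W : rep) (f : fam V W) : Prop :=
  forall (x y : R) (h : prec A y x) (v : V x),
    rep_map W h (f x v) = f y (rep_map V h v).

Definition isomorphic (V W : rep) : Prop :=
  exists (f : fam V W) (g : fam W V),
    [/\ natural f, natural g,
        forall (x : R) (v : V x), g x (f x v) = v
      & forall (x : R) (w : W x), f x (g x w) = w].

Definition is_zero (V : rep) : Prop := forall (x : R) (v : V x), v = 0.

Definition rep0 : rep.
Proof.
refine (@Rep (fun=> 'rV[k]_0 : lmodType k) (fun _ _ _ => idfun) _ _) => //.
Defined.

Definition sum_map (U1 U2 V1 V2 : lmodType k) (f1 : {linear U1 -> V1})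
    (f2 : {linear U2 -> V2}) (u : (U1 * U2)%type) : (V1 * V2)%type :=
  (f1 u.1, f2 u.2).

Lemma sum_map_linear (U1 U2 V1 V2 : lmodType k) (f1 : {linear U1 -> V1})
  (f2 : {linear U2 -> V2}) : linear (sum_map f1 f2).
Proof. by move=> a u v; rewrite /sum_map /= !linearP. Qed.

HB.instance Definition _ (U1 U2 V1 V2 : lmodType k) (f1 : {linear U1 -> V1})
    (f2 : {linear U2 -> V2}) :=
  GRing.isLinear.Build k (U1 * U2)%type (V1 * V2)%type _ (sum_map f1 f2)
    (sum_map_linear f1 f2).

Definition rep_sum (V W : rep) : rep.
Proof.
refine (@Rep (fun x => (V x * W x)%type : lmodType k)
  (fun x y h => sum_map (rep_map V h) (rep_map W h)) _ _).
- by move=> x h [v w]; rewrite /= /sum_map /= !rep_map_id.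
- move=> x y z hyx hzy hzx [v w].
  by rewrite /= /sum_map /= -!(rep_map_comp hyx hzy hzx).
Defined.

Definition rep_bigsum (s : seq rep) : rep := foldr rep_sum rep0 s.

Definition indecomposable (V : rep) : Prop :=
  ~ is_zero V /\
  forall V1 V2 : rep,
    isomorphic V (rep_sum V1 V2) -> is_zero V1 \/ is_zero V2.

(** The space at x is k^1 if x lies in I and k^0 otherwise; right
    multiplication by the all-ones matrix is the identity k^1 -> k^1 and is zero
    when the source or the target is k^0.  An interval of R is given as the
    trace on R of an interval I of the extended line: a bracket at an infinite
    endpoint of I is thus automatically read as open. *)
Definition int_sp (I : interval (\bar R)) (x : R) : lmodType k :=
  'rV[k]_(x%:E \in I).

Definition ones (b c : bool) : {linear 'rV[k]_b -> 'rV[k]_c} :=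
  mulmxr (const_mx 1).

Lemma ones_id (b : bool) (v : 'rV[k]_b) : ones b b v = v.
Proof.
case: b v => v; last by rewrite [LHS]thinmx0 [RHS]thinmx0.
have e : const_mx 1 = 1%:M :> 'M[k]_(true, true).
  by apply/matrixP => i j; rewrite !ord1 !mxE.
by rewrite /= e mulmx1.
Qed.

Lemma ones_comp (b c d : bool) (v : 'rV[k]_b) :
  (b -> d -> c) -> ones b d v = ones c d (ones b c v).
Proof.
case: b v => v h; last by rewrite [v]thinmx0 !linear0.
case: d h => h; last by rewrite [LHS]thinmx0 [RHS]thinmx0.
by case: c h => [_|/(_ isT isT)//]; rewrite !ones_id.
Qed.

Lemma itv_conv (I : interval (\bar R)) (x y z : R) :
  (z <= y <= x) || (x <= y <= z) ->
  x%:E \in I -> z%:E \in I -> y%:E \in I.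
Proof.
case: I => l r.
have sub (a b c : R) : a <= b <= c -> a%:E \in Interval l r ->
    c%:E \in Interval l r -> b%:E \in Interval l r.
  move=> /andP[ab bc]; rewrite !itv_boundlr => /andP[la _] /andP[_ cr].
  rewrite (le_trans la) ?bnd_simp ?lee_fin//=.
  by rewrite (le_trans _ cr)// bnd_simp lee_fin.
by move=> /orP[] h hx hz; apply: sub h _ _.
Qed.

Definition Mint (I : interval (\bar R)) : rep.
Proof.
refine (@Rep (int_sp I)
  (fun x y _ => ones (x%:E \in I) (y%:E \in I)) _ _).
- by move=> x _ v; apply: ones_id.
- move=> x y z hyx hzy _ v; apply: ones_comp => hx hz.
  by apply: itv_conv hx hz; apply: prec_between hyx hzy.
Defined.

Definition trace (I : interval (\bar R)) : set R := [set x | x%:E \in I].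

(** Indecomposable projectives are the [Mint I] with [proj_support I]. *)
Inductive proj_support (I : interval (\bar R)) : Prop :=
| proj_at (a : R) of trace I = [set x | prec A x a]
| proj_left (a : R) of trace I !=set0
    & trace I = [set x | prec A x a /\ x < a]
| proj_right (a : R) of trace I !=set0
    & trace I = [set x | prec A x a /\ a < x]
| proj_pinfty (n : int) of hasidx A (n - 1) & hasidx A n & ~~ evenz n
    & vtx A n = +oo%E & trace I = trace `[vtx A (n - 1), vtx A n]
| proj_ninfty (n : int) of hasidx A n & hasidx A (n + 1) & ~~ evenz n
    & vtx A n = -oo%E & trace I = trace `[vtx A n, vtx A (n + 1)].

Definition pointwise_fd (V : rep) : Prop :=
  forall x : R, exists (n : nat) (e : 'I_n -> V x),
    forall v : V x, exists c : 'I_n -> k, v = \sum_(i < n) c i *: e i.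

Definition in_repk (V : rep) : Prop :=
  pointwise_fd V /\
  exists s : seq (interval (\bar R)),
    (forall J, J \in s -> proj_support J) /\
    exists q : fam (rep_bigsum [seq Mint J | J <- s]) V,
      natural q /\ forall (x : R) (v : V x), exists u, q x u = v.

Definition short_exact (N E M : rep) (f : fam N E) (g : fam E M) : Prop :=
  forall x : R,
    [/\ injective (f x),
        forall e : E x, g x e = 0 <-> exists v : N x, f x v = e
      & forall w : M x, exists e : E x, g x e = w].

Definition is_section (V W : rep) (f : fam V W) : Prop :=
  exists2 r : fam W V, natural r & forall (x : R) (v : V x), r x (f x v) = v.

Definition is_retraction (V W : rep) (g : fam V W) : Prop :=
  exists2 t : fam W V, natural t & forall (x : R) (w : W x), g x (t x w) = w.

Definition nontrivial (V W : rep) (f : fam V W) : Prop :=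
  exists (x : R) (v : V x), f x v <> 0.

Definition AR_sequence (N E M : rep) (f : fam N E) (g : fam E M) : Prop :=
  [/\ in_repk N, in_repk E & in_repk M] /\
  [/\ natural f, natural g & short_exact f g] /\
  [/\ ~ is_section f, ~ is_retraction g, indecomposable N
    & indecomposable M] /\
  (forall (X : rep) (h : fam N X),
     in_repk X -> indecomposable X -> ~ isomorphic X N ->
     natural h -> nontrivial h ->
     exists2 h' : fam E X, natural h' &
       forall (x : R) (v : N x), h x v = h' x (f x v)) /\
  (forall (X : rep) (h : fam X M),
     in_repk X -> indecomposable X -> ~ isomorphic X M ->
     natural h -> nontrivial h ->
     exists2 h' : fam X E, natural h' &
       forall (x : R) (v : X x), h x v = g x (h' x v)).

(** The entry 1 of the matrices [1; 1] and [1 -1], from Mint I to Mint J, is the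
    identity of k at the points of both I and J, and zero elsewhere. *)
Definition mono11_fun (N I1 I2 : interval (\bar R)) (x : R)
    (v : Mint N x) : rep_sum (Mint I1) (Mint I2) x :=
  (ones (x%:E \in N) (x%:E \in I1) v, ones (x%:E \in N) (x%:E \in I2) v).

Lemma mono11_linear (N I1 I2 : interval (\bar R)) (x : R) :
  linear (@mono11_fun N I1 I2 x).
Proof. by move=> a u v; rewrite /mono11_fun !linearP. Qed.

HB.instance Definition _ (N I1 I2 : interval (\bar R)) (x : R) :=
  GRing.isLinear.Build k (Mint N x) (rep_sum (Mint I1) (Mint I2) x) _
    (@mono11_fun N I1 I2 x) (@mono11_linear N I1 I2 x).

Definition mono11 (N I1 I2 : interval (\bar R)) :
  fam (Mint N) (rep_sum (Mint I1) (Mint I2)) :=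
  fun x => @mono11_fun N I1 I2 x.

Definition epi1N1_fun (I1 I2 M : interval (\bar R)) (x : R)
    (u : rep_sum (Mint I1) (Mint I2) x) : Mint M x :=
  ones (x%:E \in I1) (x%:E \in M) u.1 - ones (x%:E \in I2) (x%:E \in M) u.2.

Lemma epi1N1_linear (I1 I2 M : interval (\bar R)) (x : R) :
  linear (@epi1N1_fun I1 I2 M x).
Proof.
move=> a u v.
by rewrite /epi1N1_fun /= !mulmxDl -!scalemxAl scalerBr opprD addrACA.
Qed.

HB.instance Definition _ (I1 I2 M : interval (\bar R)) (x : R) :=
  GRing.isLinear.Build k (rep_sum (Mint I1) (Mint I2) x) (Mint M x) _
    (@epi1N1_fun I1 I2 M x) (@epi1N1_linear I1 I2 M x).

Definition epi1N1 (I1 I2 M : interval (\bar R)) :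
  fam (rep_sum (Mint I1) (Mint I2)) (Mint M) :=
  fun x => @epi1N1_fun I1 I2 M x.

End Representations.

(** [N], [I1], [I2], [M] are the supports of the terms of
    0 -> Mint N -> Mint I1 (+) Mint I2 -> Mint M -> 0. *)

Inductive seq_type (R : realType) (A : cquiver R) :
  interval (\bar R) -> interval (\bar R) -> interval (\bar R) ->
  interval (\bar R) -> Prop :=
| type1 (a b : R) (sa sb : \bar R) of
    a < b & ~ cq_S A a & ~ cq_S A b & surrounding_sink A a sa & surrounding_sink A b sb
    & (sa < a%:E)%E & (sb < b%:E)%E :
    seq_type A `[a%:E, b%:E[ `[a%:E, b%:E] `]a%:E, b%:E[ `]a%:E, b%:E]
| type2 (a b : R) (sa sb : \bar R) of
    a < b & ~ cq_S A a & ~ cq_S A b & surrounding_sink A a sa & surrounding_sink A b sb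
    & (sa < a%:E)%E & (b%:E < sb)%E :
    seq_type A `[a%:E, b%:E] `[a%:E, b%:E[ `]a%:E, b%:E] `]a%:E, b%:E[
| type3 (a b : R) (sa sb : \bar R) of
    a < b & ~ cq_S A a & ~ cq_S A b & surrounding_sink A a sa & surrounding_sink A b sb
    & (a%:E < sa)%E & (sb < b%:E)%E :
    seq_type A `]a%:E, b%:E[ `]a%:E, b%:E] `[a%:E, b%:E[ `[a%:E, b%:E]
| type4 (a b : R) (sa sb : \bar R) of
    a < b & ~ cq_S A a & ~ cq_S A b & surrounding_sink A a sa & surrounding_sink A b sb
    & (a%:E < sa)%E & (b%:E < sb)%E :
    seq_type A `]a%:E, b%:E] `]a%:E, b%:E[ `[a%:E, b%:E] `[a%:E, b%:E[
| type5 (n : int) (b : R) (sb : \bar R) of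
    hasidx A (2 * n - 1) & hasidx A (2 * n)
    & (vtx A (2 * n - 1) < vtx A (2 * n) < b%:E)%E
    & ~ cq_S A b & surrounding_sink A b sb & (sb < b%:E)%E :
    seq_type A `[vtx A (2 * n - 1), b%:E[
      `[vtx A (2 * n - 1), b%:E] `]vtx A (2 * n), b%:E[
      `]vtx A (2 * n), b%:E]
| type6 (n : int) (b : R) (sb : \bar R) of
    hasidx A (2 * n - 1) & hasidx A (2 * n)
    & (vtx A (2 * n - 1) < vtx A (2 * n) < b%:E)%E
    & ~ cq_S A b & surrounding_sink A b sb & (b%:E < sb)%E :
    seq_type A `[vtx A (2 * n - 1), b%:E]
      `[vtx A (2 * n - 1), b%:E[ `]vtx A (2 * n), b%:E]
      `]vtx A (2 * n), b%:E[
| type7 (n : int) (b : R) (sb : \bar R) of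
    hasidx A (2 * n) & hasidx A (2 * n + 1)
    & (vtx A (2 * n) < vtx A (2 * n + 1) < b%:E)%E
    & ~ cq_S A b & surrounding_sink A b sb & (sb < b%:E)%E :
    seq_type A `]vtx A (2 * n + 1), b%:E[
      `]vtx A (2 * n + 1), b%:E] `[vtx A (2 * n), b%:E[
      `[vtx A (2 * n), b%:E]
| type8 (n : int) (b : R) (sb : \bar R) of
    hasidx A (2 * n) & hasidx A (2 * n + 1)
    & (vtx A (2 * n) < vtx A (2 * n + 1) < b%:E)%E
    & ~ cq_S A b & surrounding_sink A b sb & (b%:E < sb)%E :
    seq_type A `]vtx A (2 * n + 1), b%:E]
      `]vtx A (2 * n + 1), b%:E[ `[vtx A (2 * n), b%:E]
      `[vtx A (2 * n), b%:E[
| type9 (n : int) (a : R) (sa : \bar R) of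
    hasidx A (2 * n) & hasidx A (2 * n + 1)
    & (a%:E < vtx A (2 * n) < vtx A (2 * n + 1))%E
    & ~ cq_S A a & surrounding_sink A a sa & (sa < a%:E)%E :
    seq_type A `[a%:E, vtx A (2 * n + 1)]
      `[a%:E, vtx A (2 * n)[ `]a%:E, vtx A (2 * n + 1)]
      `]a%:E, vtx A (2 * n)[
| type10 (n : int) (a : R) (sa : \bar R) of
    hasidx A (2 * n) & hasidx A (2 * n + 1)
    & (a%:E < vtx A (2 * n) < vtx A (2 * n + 1))%E
    & ~ cq_S A a & surrounding_sink A a sa & (a%:E < sa)%E :
    seq_type A `]a%:E, vtx A (2 * n + 1)]
      `]a%:E, vtx A (2 * n)[ `[a%:E, vtx A (2 * n + 1)]
      `[a%:E, vtx A (2 * n)[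
| type11 (n : int) (a : R) (sa : \bar R) of
    hasidx A (2 * n - 1) & hasidx A (2 * n)
    & (a%:E < vtx A (2 * n - 1) < vtx A (2 * n))%E
    & ~ cq_S A a & surrounding_sink A a sa & (sa < a%:E)%E :
    seq_type A `[a%:E, vtx A (2 * n - 1)[
      `[a%:E, vtx A (2 * n)] `]a%:E, vtx A (2 * n - 1)[
      `]a%:E, vtx A (2 * n)]
| type12 (n : int) (a : R) (sa : \bar R) of
    hasidx A (2 * n - 1) & hasidx A (2 * n)
    & (a%:E < vtx A (2 * n - 1) < vtx A (2 * n))%E
    & ~ cq_S A a & surrounding_sink A a sa & (a%:E < sa)%E :
    seq_type A `]a%:E, vtx A (2 * n - 1)[
      `]a%:E, vtx A (2 * n)] `[a%:E, vtx A (2 * n - 1)[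
      `[a%:E, vtx A (2 * n)]
| type13 (m n : int) of
    hasidx A (2 * m) & hasidx A (2 * m + 1)
    & hasidx A (2 * n) & hasidx A (2 * n + 1)
    & (vtx A (2 * m) < vtx A (2 * m + 1))%E
    & (vtx A (2 * m + 1) < vtx A (2 * n))%E
    & (vtx A (2 * n) < vtx A (2 * n + 1))%E :
    seq_type A `]vtx A (2 * m + 1), vtx A (2 * n + 1)]
      `]vtx A (2 * m + 1), vtx A (2 * n)[
      `[vtx A (2 * m), vtx A (2 * n + 1)]
      `[vtx A (2 * m), vtx A (2 * n)[
| type14 (m n : int) of
    hasidx A (2 * m - 1) & hasidx A (2 * m)
    & hasidx A (2 * n) & hasidx A (2 * n + 1)
    & (vtx A (2 * m - 1) < vtx A (2 * m))%E
    & (vtx A (2 * m) < vtx A (2 * n))%E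
    & (vtx A (2 * n) < vtx A (2 * n + 1))%E :
    seq_type A `[vtx A (2 * m - 1), vtx A (2 * n + 1)]
      `[vtx A (2 * m - 1), vtx A (2 * n)[
      `]vtx A (2 * m), vtx A (2 * n + 1)]
      `]vtx A (2 * m), vtx A (2 * n)[
| type15 (m n : int) of
    hasidx A (2 * m) & hasidx A (2 * m + 1)
    & hasidx A (2 * n - 1) & hasidx A (2 * n)
    & (vtx A (2 * m) < vtx A (2 * m + 1))%E
    & (vtx A (2 * m + 1) < vtx A (2 * n - 1))%E
    & (vtx A (2 * n - 1) < vtx A (2 * n))%E :
    seq_type A `]vtx A (2 * m + 1), vtx A (2 * n - 1)[
      `]vtx A (2 * m + 1), vtx A (2 * n)]
      `[vtx A (2 * m), vtx A (2 * n - 1)[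
      `[vtx A (2 * m), vtx A (2 * n)]
| type16 (m n : int) of
    hasidx A (2 * m - 1) & hasidx A (2 * m)
    & hasidx A (2 * n - 1) & hasidx A (2 * n)
    & (vtx A (2 * m - 1) < vtx A (2 * m))%E
    & (vtx A (2 * m) < vtx A (2 * n - 1))%E
    & (vtx A (2 * n - 1) < vtx A (2 * n))%E :
    seq_type A `[vtx A (2 * m - 1), vtx A (2 * n - 1)[
      `[vtx A (2 * m - 1), vtx A (2 * n)]
      `]vtx A (2 * m), vtx A (2 * n - 1)[
      `]vtx A (2 * m), vtx A (2 * n)].

(* Main.v *)
(** A map out of an interval representation is a compatible family of vectors,
    and a map into it is a compatible family of functionals.  The classification
    of the indecomposables is not needed: for every pointwise finite-dimensional
    X, a map h : N -> X either factors through the monomorphism or splits, and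
    dually for X -> M; when X is indecomposable, a split map is an isomorphism,
    which is excluded.

    All 16 types consist of a core ]p, q[ with a block [l, p] and a block [q, r]
    at its ends, a block lying in the support of either N or M.  Pick e and f in
    the core, close to p and q.  Factoring h amounts to finding a compatible
    family of vectors on [e, f] whose values at e and f lie in cosets of
    explicit subspaces (the kernel of X(e) -> X(p) or the image of
    X(p) -> X(e), and likewise at f).  By duality on [e, f], which is proved by
    induction along the segments between consecutive vertices, the obstruction
    is a compatible family of functionals that extends to a map X -> N and is
    nonzero on h; the composite N -> X -> N is then a nonzero scalar. *)

Require Import Defs.
From HB Require Import structures.
From mathcomp Require Import all_boot all_order all_algebra.
From mathcomp Require Import all_classical all_reals all_analysis.
From mathcomp Require Import zify.
Set Implicit Arguments.
Unset Strict Implicit.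
Unset Printing Implicit Defensive.
Import Order.TTheory GRing.Theory Num.Theory.
Local Open Scope ring_scope.

(** Each functional to be found is prescribed on a span of vectors coming from families. That the
    prescription is well defined is a gluing statement about families, and it then extends to the
    whole space by finite dimension. Since [[e, f]] meets only finitely many segments, such choices
    are made at finitely many vertices; inside a segment everything is transport.

    The points [e] and [f] lie inside the core because all arrows near an end of the core have one
    direction: a value at [e] is carried over the end by transport from [e] or from [p].

    Reversing arrows exchanges vectors with functionals and N with M. Diagrams therefore carry only
    abelian groups and an abstract relation, so that splitting over the ends is proved once.

    The other clauses rest on scalars: a morphism between interval representations is one scalar on
    the intersection of the supports. Hence N and M have only scalar endomorphisms, and a splitting
    would have components that vanish because their supports differ at an end. Membership in the
    category comes from covering a support by the down-closures of its pieces, one for each segment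
    whose interior it meets. *)

Section LinearRelations.
Context {k : fieldType}.

(** * Linear algebra: functionals extended from linear relations *)

Definition subspace (V : lmodType k) (W : V -> Prop) : Prop :=
  W 0 /\ forall (a : k) (u v : V), W u -> W v -> W (a *: u + v).

(** Phrased as an induction principle over subspaces: a linear property checked on the generators
    holds for all vectors, without coordinates. *)
Definition fingen (V : lmodType k) : Prop :=
  exists s : seq V, forall W : V -> Prop,
    subspace W -> (forall v, v \in s -> W v) -> forall v, W v.

Lemma subspaceD (V : lmodType k) (W : V -> Prop) u v :
  subspace W -> W u -> W v -> W (u + v).
Proof. by move=> [_ h] hu hv; rewrite -[u]scale1r; apply: h. Qed.

Lemma subspaceZ (V : lmodType k) (W : V -> Prop) a u :
  subspace W -> W u -> W (a *: u).
Proof. by move=> [h0 h] hu; rewrite -[_ *: _]addr0; apply: h. Qed.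

Lemma subspaceN (V : lmodType k) (W : V -> Prop) u :
  subspace W -> W u -> W (- u).
Proof. by rewrite -scaleN1r; apply: subspaceZ. Qed.

Lemma subspaceB (V : lmodType k) (W : V -> Prop) u v :
  subspace W -> W u -> W v -> W (u - v).
Proof. by move=> hW hu hv; apply: subspaceD => //; apply: subspaceN. Qed.

Lemma fingen_prod (V W : lmodType k) :
  fingen V -> fingen W -> fingen (V * W)%type.
Proof.
move=> [s hs] [r hr].
exists ([seq (v, 0) | v <- s] ++ [seq (0, w) | w <- r]) => U hU sub.
have subl v : U (v, 0).
  move: v; apply: hs => [|v vs].
    split=> [|a u v]; first by case: hU.
    have -> : (a *: u + v, 0) = a *: (u, 0) + (v, 0) :> (V * W)%type.
      by apply: injective_projections; rewrite //= scaler0 addr0.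
    by case: hU => _; apply.
  by apply: sub; rewrite mem_cat (map_f (fun v => (v, 0))).
have subr w : U (0, w).
  move: w; apply: hr => [|w wr].
    split=> [|a u v]; first by case: hU.
    have -> : (0, a *: u + v) = a *: (0, u) + (0, v) :> (V * W)%type.
      by apply: injective_projections; rewrite //= scaler0 addr0.
    by case: hU => _; apply.
  by apply: sub; rewrite mem_cat (map_f (fun w => (0, w))) ?orbT.
move=> [v w].
have -> : (v, w) = (v, 0) + (0, w) by apply: injective_projections; rewrite /= ?addr0 ?add0r.
exact: subspaceD.
Qed.

(** A bare sigma type, which below receives just the additive structure that a diagram asks of its
    spaces. *)
Definition dual (V : lmodType k) : Type := {f : V -> k | linear_for *%R f}.

Definition dual_fun (V : lmodType k) (f : dual V) : V -> k := sval f.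
Coercion dual_fun : dual >-> Funclass.

Lemma dualP (V : lmodType k) (f g : dual V) : f =1 g -> f = g.
Proof.
case: f g => [f hf] [g hg] /funext e; rewrite /dual_fun /= in e.
by subst g; rewrite (Prop_irrelevance hf hg).
Qed.

Section DualTheory.
Variables (V : lmodType k) (f : dual V).

Lemma dual_lin a u v : f (a *: u + v) = a * f u + f v.
Proof. by case: f => g hg; apply: hg. Qed.

Lemma dualD u v : f (u + v) = f u + f v.
Proof. by rewrite -[u]scale1r dual_lin scale1r mul1r. Qed.

Lemma dual0 : f 0 = 0.
Proof. by apply: (addrI (f 0)); rewrite -dualD !addr0. Qed.

Lemma dualZ a u : f (a *: u) = a * f u.
Proof. by rewrite -[a *: u]addr0 dual_lin dual0 addr0. Qed.

Lemma dualN u : f (- u) = - f u.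
Proof. by rewrite -scaleN1r dualZ mulN1r. Qed.

End DualTheory.

(** The condition at 0 makes the relation [G] the graph of a functional on a subspace of [V]. Its
    domain is enlarged by one generator at a time, so finite generation stands in for Zorn's
    lemma. *)
Lemma linear_relation_extends (V : lmodType k) (G : V * k^o -> Prop) :
  fingen V -> subspace G -> (forall c, G (0, c) -> c = 0) ->
  exists f : dual V, forall v c, G (v, c) -> f v = c.
Proof.
move=> [s hs] hG G0.
have step (G1 : (V * k^o) -> Prop) (e : V) :
    subspace G1 -> (forall c, G1 (0, c) -> c = 0) ->
    exists G2 : (V * k^o) -> Prop,
      [/\ subspace G2, forall c, G2 (0, c) -> c = 0,
          forall z, G1 z -> G2 z & exists c, G2 (e, c)].
  move=> h1 h10; have [he|he] := pselect (exists c, G1 (e, c)).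
    by exists G1; split.
  (* [G1] is enlarged by the line through [(e, 0)], so the extension takes the value 0 at [e]. It
     stays single-valued because [e] is not in the domain of [G1]. *)
  exists (fun z => exists a, G1 (z.1 - a *: e, z.2)); split.
  - split; first by exists 0; rewrite scale0r subr0; case: h1.
    move=> a [u c] [v d] [b /= hb] [b' /= hb']; exists (a * b + b') => /=.
    have -> : (a *: u + v - (a * b + b') *: e, a *: c + d) =
        a *: (u - b *: e, c) + (v - b' *: e, d) :> (V * k^o)%type.
      apply: injective_projections; rewrite //=.
      by rewrite scalerBr scalerA scalerDl opprD addrACA.
    by case: h1 => _; apply.
  - move=> c [a] /=; rewrite sub0r => ha.
    have [a0|a0] := eqVneq a 0; first by apply: h10; rewrite a0 scale0r oppr0 in ha.
    case: he; exists (- a^-1 * c).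
    have -> : (e, - a^-1 * c) = (- a^-1) *: (- (a *: e), c) :> (V * k^o)%type.
      apply: injective_projections; rewrite //=.
      by rewrite scaleNr scalerN opprK scalerA mulVf// scale1r.
    exact: subspaceZ.
  - by move=> [v c] h; exists 0; rewrite scale0r subr0.
  - by exists 0, 1; rewrite /= scale1r subrr; case: h1.
have [G' [hG' G'0 GG' dom]] : exists G' : (V * k^o) -> Prop,
    [/\ subspace G', forall c, G' (0, c) -> c = 0, forall z, G z -> G' z
      & forall v, v \in s -> exists c, G' (v, c)].
  elim: s {hs} => [|e s [G1 [h1 h2 h3 h4]]]; first by exists G; split.
  have [G2 [g1 g2 g3 [d g4]]] := step G1 e h1 h2.
  exists G2; split=> // [z /h3/g3//|v].
  by rewrite inE => /orP[/eqP->|/h4[c /g3 hc]]; [exists d | exists c].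
have tot : forall v, exists c, G' (v, c).
  apply: hs => //; split; first by exists 0; case: hG'.
  by move=> a u v [c hc] [d hd]; exists (a *: (c : k^o) + d); have [_ h] := hG'; exact: (h a (u, c) (v, d) hc hd).
pose f v := sval (cid (tot v)).
have fP v : G' (v, f v) by rewrite /f; case: cid.
have fE v c : G' (v, c) -> f v = c.
  move=> h; apply/subr0_eq/G'0.
  have -> : (0, f v - c) = (v, f v) - (v, c) :> (V * k^o)%type.
    by apply: injective_projections; rewrite //= subrr.
  exact: subspaceB.
have flin : linear_for *%R f.
  move=> a u v; apply: fE.
  have [_ h] := hG'; exact: (h a (u, f u) (v, f v)).
by exists (exist _ f flin) => v c /GG' /fE.
Qed.

End LinearRelations.

Section DualZmodule.
Context {k : fieldType}.
Variable V : lmodType k.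

HB.instance Definition _ := gen_eqMixin (dual V).
HB.instance Definition _ := gen_choiceMixin (dual V).

Let dzero : dual V.
Proof. by exists (fun=> 0) => a u v; rewrite mulr0 addr0. Defined.

Let dadd (f g : dual V) : dual V.
Proof.
exists (fun v => f v + g v) => a u v.
by rewrite !dual_lin mulrDr addrACA.
Defined.

Let dopp (f : dual V) : dual V.
Proof. by exists (fun v => - f v) => a u v; rewrite dual_lin opprD mulrN. Defined.

Let daddA : associative dadd.
Proof. by move=> f g h; apply: dualP => v; apply: addrA. Qed.
Let daddC : commutative dadd.
Proof. by move=> f g; apply: dualP => v; apply: addrC. Qed.
Let dadd0 : left_id dzero dadd.
Proof. by move=> f; apply: dualP => v; apply: add0r. Qed.
Let daddN : left_inverse dzero dopp dadd.
Proof. by move=> f; apply: dualP => v; apply: addNr. Qed.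

HB.instance Definition _ :=
  GRing.isZmodule.Build (dual V) daddA daddC dadd0 daddN.

Lemma dual_subE (f g : dual V) v : dual_fun (f - g) v = f v - g v.
Proof. by []. Qed.
Lemma dual_zeroE v : dual_fun (0 : dual V) v = 0.
Proof. by []. Qed.

End DualZmodule.

Definition dual_comp {k : fieldType} {V W : lmodType k} (g : {linear V -> W})
  (f : dual W) : dual V.
Proof. by exists (fun v => f (g v)) => a u v; rewrite linearP dual_lin. Defined.

(** [le y x] stands for an arrow from x to y; off the arrows [act] is junk. *)
Record diagram (T : Type) (le : T -> T -> Prop) := Diagram {
  dsp :> T -> zmodType;
  act : forall x y, dsp x -> dsp y;
  actB : forall x y u v, @act x y (u - v) = @act x y u - @act x y v;
  act_id : forall x u, le x x -> @act x x u = u;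
  act_comp : forall x y z u, le y x -> le z y -> le z x ->
    @act x z u = @act y z (@act x y u) }.

Arguments act {T le d} x y u.
Arguments act_comp {T le d} [x y z] u.

(** The boolean chooses whether arrows are read backwards, so that one description of an end covers
    both orientations. *)
Definition ordirect (T : Type) (le : T -> T -> Prop) (d : bool) (y x : T) :=
  if d then le y x else le x y.

(** The region O ends in a block P with distinguished point p, next to which
    lies the half-open interval L from p (excluded) to e (included).  Arrows
    inside L point to p, those inside P point to p as well. *)
Record endfacts (T : Type) (le : T -> T -> Prop) (O P L : T -> bool) (p e : T)
  : Prop := Endfacts {
  ef_p : P p /\ O p;
  ef_e : L e /\ O e;
  ef_L : forall x, L x -> le x e /\ le p x;
  ef_from_L : forall x y, L x -> O y -> le y x -> L y \/ le y p /\ le y e;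
  ef_P_L : forall x y, P x -> L y -> ~ le y x;
  ef_P : forall x, P x -> le x x /\ le p x;
  ef_into : forall x y, P x || L x -> O y -> le x y -> P y || L y }.

(** * Compatible families on diagrams: splitting at an end, gluing at a point *)

Section Sections.
Context {T : Type} {le : T -> T -> Prop} (Y : diagram le).

(** An arrow that starts in [J] and leaves it must kill the vector, while an arrow that starts
    outside [J] imposes nothing. For [D] everything and [J] an interval, these are the morphisms out
    of [Mint J]; in the dual diagram, the morphisms into it. *)
Definition family_on (D : T -> Prop) (J : T -> bool) (t : forall x, Y x) :=
  (forall x, D x -> ~~ J x -> t x = 0) /\
  (forall x y, D x -> D y -> J x -> le y x -> act x y (t x) = t y).

Lemma act0 x y : act x y (0 : Y x) = 0.
Proof. by rewrite -(subrr 0) actB subrr. Qed.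

Lemma family_on_sub (D D' : T -> Prop) J t :
  (forall x, D' x -> D x) -> family_on D J t -> family_on D' J t.
Proof.
move=> s [h0 h]; split=> [x /s|x y /s hx /s hy]; [exact: h0 | exact: h].
Qed.

Lemma family_on_eq (D : T -> Prop) (J J' : T -> bool) t :
  (forall x, D x -> J x = J' x) -> family_on D J t -> family_on D J' t.
Proof.
move=> e [h0 h]; split=> [x Dx|x y Dx Dy]; rewrite -e//; [exact: h0|exact: h].
Qed.

Lemma family_onB (D : T -> Prop) J t t' :
  family_on D J t -> family_on D J t' ->
  family_on D J (fun x => t x - t' x).
Proof.
move=> [h0 h] [h0' h']; split=> [x Dx Jx|x y Dx Dy Jx yx].
  by rewrite h0// h0'// subrr.
by rewrite actB h// h'.
Qed.

(** The values at [e] that extend over the end with support [JM]: if [d], the block is outside that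
    support and the vector must die at [p]; otherwise the block is inside and the vector must come
    from [p]. *)
Definition admissible (d : bool) (p e : T) (u : Y e) : Prop :=
  if d then act e p u = 0 else exists a : Y p, u = act p e a.

Variables (d : bool) (O P L : T -> bool) (p e : T).
Hypothesis ef : endfacts (ordirect le d) O P L p e.

Let JN x := L x || d && P x.
Let JM x := L x || ~~ d && P x.

(** It suffices to extend [w] to a family [m] on [JM] that is also compatible along the arrows
    starting in [JN]; then [tm] is [m] and [tn] is [t - m] on [JN]. If [d], [m] is the transport of
    [w] from [e] over [L], and it dies beyond [L] because such arrows pass through [p]. Otherwise
    [w = act p e a], and [m] is the transport of [a] from [p]. *)
Lemma end_split (t : forall x, Y x) (w : Y e) :
  family_on O JN t -> admissible d p w ->
  exists tn tm : forall x, Y x,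
    [/\ family_on O JN tn, family_on O JM tm, tm e = w, tn e = t e - w
      & forall x, O x -> JN x -> t x = tn x + tm x].
Proof.
rewrite /admissible.
have [[Pp Op] [Le Oe] fL fLy fPL fP fin] := ef.
move=> [t0 tc] adm.
suff [m [hm me hmN]] : exists m : forall x, Y x, [/\ family_on O JM m, m e = w
    & forall x y, O x -> O y -> JN x -> le y x ->
      act x y (m x) = if JN y then m y else 0].
  exists (fun x => if JN x then t x - m x else 0), m; split=> //.
  - split=> [x _ /negbTE->//|x y Ox Oy Jx yx].
    rewrite Jx actB tc// hmN//; case: ifP => // /negbT /t0->//; exact: subr0.
  - by rewrite /JN Le /= me.
  - by move=> x Ox Jx; rewrite Jx subrK.
move: adm; rewrite /JN /JM; case: (d) ef fL fLy fPL fP fin => /= _ fL fLy fPL fP fin.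
- move=> w0; exists (fun x => if L x then act e x w else 0).
  have red x y : O x -> O y -> L x -> le y x ->
      act x y (act e x w) = if L y then act e y w else 0.
    move=> Ox Oy Lx yx; have [xe px] := fL _ Lx; have [_ pe] := fL _ Le.
    case: ifP => Ly.
      by have [ye _] := fL _ Ly; rewrite -act_comp.
    have [|[yp ye]] := fLy _ _ Lx Oy yx; first by rewrite Ly.
    rewrite (@act_comp _ _ Y _ _ _ _ px yp yx) -(@act_comp _ _ Y _ _ _ _ xe px pe).
    by rewrite w0 act0.
  split.
  + split=> [x Ox|x y Ox Oy]; rewrite orbF; first by move=> /negbTE->.
    by move=> Lx yx; rewrite Lx red.
  + by have [ee _] := fL _ Le; rewrite Le act_id.
  + move=> x y Ox Oy; case: (boolP (L x)) => Lx /=.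
      by move=> _ yx; rewrite red//; case: (L y) => //=; case: ifP.
    move=> Px yx; rewrite act0; case: (boolP (L y)) => //= Ly.
      by have := fPL _ _ Px Ly yx.
    by case: ifP.
- move=> [a wa]; exists (fun x => if L x || P x then act p x a else 0).
  have LPp x : L x || P x -> le x p.
    by move=> /orP[/fL[]|/fP[]].
  have clos x y : L x || P x -> O y -> le y x -> L y || P y.
    by rewrite orbC => LPx Oy yx; rewrite orbC (fin x).
  have red x y : L x || P x -> O y -> le y x -> act x y (act p x a) = act p y a.
    move=> LPx Oy yx; rewrite -act_comp//; first exact: LPp.
    by apply: LPp; apply: clos yx.
  split.
  + split=> [x Ox /negbTE->//|x y Ox Oy Jx yx].
    by rewrite Jx red// (clos x).
  + by rewrite Le wa.
  + move=> x y Ox Oy; rewrite orbF => Lx yx.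
    rewrite Lx red ?Lx//; have := clos x y; rewrite Lx => /(_ isT Oy yx).
    rewrite orbF; case: (boolP (L y)) => //= Ly Py.
    by have := fPL _ _ Py Lx yx.
Qed.

End Sections.

Arguments family_on {T le} Y D J t.
Arguments admissible {T le} Y d p [e] u.

Section Glue.
Context {R : realType} {le : R -> R -> Prop} (Y : diagram le).
Hypothesis le_mid : forall x y c, le y x -> (x <= c <= y) || (y <= c <= x) ->
  le y c /\ le c x.

(** An arrow joining the two sides of [c] factors through [c] by [le_mid], so agreement at [c] makes
    it compatible. *)
Lemma family_glue (D : R -> Prop) (J : R -> bool) (c : R)
    (t1 t2 : forall x, Y x) :
  D c -> J c -> t1 c = t2 c ->
  family_on Y (fun x => D x /\ x <= c) J t1 ->
  family_on Y (fun x => D x /\ c <= x) J t2 ->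
  family_on Y D J (fun x => if x <= c then t1 x else t2 x).
Proof.
move=> Dc Jc e [h1 k1] [h2 k2]; split=> [x Dx Jx|x y Dx Dy Jx yx].
  by case: (leP x c) => xc; [apply: h1 | apply: h2 => //; split=> //; apply: ltW].
case: (leP x c) => xc; case: (leP y c) => yc.
- exact: k1.
- have [yc' cx] := le_mid yx (c := c) ltac:(by rewrite xc (ltW yc)).
  by rewrite (act_comp _ cx yc' yx)// k1// e k2//; split=> //; apply: ltW.
- have [yc' cx] := le_mid yx (c := c) ltac:(by rewrite yc (ltW xc) orbT).
  rewrite (act_comp _ cx yc' yx)// k2 -?e ?k1//; split=> //; exact: ltW.
- by apply: k2 => //; split=> //; apply: ltW.
Qed.

End Glue.

Lemma evenzD1 (n : int) : evenz (n + 1) = ~~ evenz n.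
Proof. by rewrite /evenz; lia. Qed.

(** * The order on segments between consecutive vertices, and the two ends of the core *)

Section Segments.
Context {R : realType} (A : cquiver R).
Implicit Types (x y z p q : R) (m n i j : int).

Definition seg n x := (vtx A n <= x%:E)%E && (x%:E <= vtx A (n + 1))%E.

Lemma hasidx_mid i j n : hasidx A i -> hasidx A j -> i <= n -> n <= j ->
  hasidx A n.
Proof. by move=> hi hj ni nj; apply: (cq_idx_convex hi hj); rewrite lee_fin. Qed.

Lemma vtx_inj_le m n : hasidx A m -> hasidx A n ->
  (vtx A m <= vtx A n)%E -> m <= n.
Proof.
by move=> hm hn; apply: contraTT; rewrite -ltNge -ltNge => /(vtx_ltn hn hm).
Qed.

Lemma vtx_inj_lt m n : hasidx A m -> hasidx A n ->
  (vtx A m < vtx A n)%E -> m < n.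
Proof.
by move=> hm hn; apply: contraTT; rewrite -!leNgt => /(vtx_leq hn hm).
Qed.

Lemma seg_interior m n x : hasidx A m -> hasidx A (m + 1) ->
  hasidx A n -> hasidx A (n + 1) ->
  (vtx A m < x%:E)%E -> (x%:E < vtx A (m + 1))%E -> seg n x -> n = m.
Proof.
move=> hm hm1 hn hn1 mx xm /andP[nx xn].
have := vtx_inj_lt hm hn1 (lt_le_trans mx xn).
have := vtx_inj_lt hn hm1 (le_lt_trans nx xm).
lia.
Qed.

(** [prec] hides its segment existentially. If [x] and [y] also lie together in a different segment,
    both are the shared vertex, and then either inequality holds. *)
Lemma precE n x y : hasidx A n -> hasidx A (n + 1) -> seg n x -> seg n y ->
  prec A y x <-> if evenz n then y <= x else x <= y.
Proof.
move=> hn hn1 sx sy; split; last first.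
  by exists n; split=> //; rewrite itv_boundlr /= !bnd_simp.
move=> [m [hm hm1]]; rewrite !itv_boundlr /= !bnd_simp => my mx.
have [mn|nm|<-//] := ltgtP m n.
- suff -> : y = x by move=> _; case: ifP; rewrite lexx.
  have le : (vtx A (m + 1) <= vtx A n)%E by apply: vtx_leq => //; lia.
  case/andP: sx sy mx my => [nx _] /andP[ny _] /andP[_ xm] /andP[_ ym].
  apply/le_anti; rewrite -!lee_fin.
  by rewrite (le_trans ym (le_trans le nx)) (le_trans xm (le_trans le ny)).
- suff -> : y = x by move=> _; case: ifP; rewrite lexx.
  have le : (vtx A (n + 1) <= vtx A m)%E by apply: vtx_leq => //; lia.
  case/andP: sx sy mx my => [_ xn] /andP[_ yn] /andP[mx _] /andP[my _].
  apply/le_anti; rewrite -!lee_fin.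
  by rewrite (le_trans yn (le_trans le mx)) (le_trans xn (le_trans le my)).
Qed.

Lemma ordirectE d n x y : hasidx A n -> hasidx A (n + 1) ->
  seg n x -> seg n y ->
  ordirect (prec A) d y x <-> if evenz n == d then y <= x else x <= y.
Proof.
move=> hn hn1 sx sy; case: d; rewrite /ordirect (precE hn hn1)//.
  by rewrite eqb_id.
by rewrite eqbF_neg; case: ifP.
Qed.

Lemma prec_seg x y : prec A y x ->
  exists n, [/\ hasidx A n, hasidx A (n + 1), seg n x & seg n y].
Proof.
move=> [n [hn hn1]]; rewrite !itv_boundlr /= !bnd_simp => ny nx _.
by exists n.
Qed.

Lemma ordirect_seg d x y : ordirect (prec A) d y x ->
  exists n, [/\ hasidx A n, hasidx A (n + 1), seg n x & seg n y].
Proof. by case: d => /prec_seg[n []]; exists n. Qed.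

Lemma prec_mid x y c : prec A y x -> (x <= c <= y) || (y <= c <= x) ->
  prec A y c /\ prec A c x.
Proof.
move=> yx; have [n [hn hn1 sx sy]] := prec_seg yx => hc.
have sc : seg n c.
  case/andP: sx sy => nx xn /andP[ny yn].
  case/orP: hc => /andP[h1 h2]; apply/andP; split.
  - by rewrite (le_trans nx)// lee_fin.
  - by rewrite (le_trans _ yn)// lee_fin.
  - by rewrite (le_trans ny)// lee_fin.
  - by rewrite (le_trans _ xn)// lee_fin.
move: yx; rewrite !(precE hn hn1)//.
by case: ifP => _ xy; move: hc => /orP[] /andP[h1 h2]; split=> //;
   rewrite ?(le_trans h1)// ?(le_trans h2)// ?(le_trans xy)// ?(le_trans _ h1)//
     ?(le_trans _ h2).
Qed.

(** Induction on the number of segments between [i] and [j]: a pair straddling the first inner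
    vertex is cut there. *)
Lemma chain_ind (T : R -> R -> Prop) i j :
  hasidx A i -> hasidx A j -> i < j ->
  (forall n x y, hasidx A n -> hasidx A (n + 1) -> seg n x -> seg n y ->
     x <= y -> T x y) ->
  (forall x y z, x <= y -> y <= z -> T x y -> T y z -> T x z) ->
  forall x y, (vtx A i <= x%:E)%E -> x <= y -> (y%:E <= vtx A j)%E -> T x y.
Proof.
move=> hi hj ij base tr.
have [n jE] : exists n : nat, j = i + 1 + n%:Z by exists (absz (j - i - 1)%R); lia.
rewrite {ij}jE in hj *.
elim: n i hi hj => [|n IH] i hi hj x y ix xy yj.
  rewrite addr0 in hj yj; apply: (base i) => //; rewrite /seg.
    by rewrite ix (le_trans _ yj)// lee_fin.
  by rewrite yj (le_trans ix)// lee_fin.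
have hi1 : hasidx A (i + 1) by apply: (hasidx_mid hi hj); lia.
have eE : i + 1 + n.+1%:Z = i + 1 + 1 + n%:Z by lia.
rewrite eE in hj yj.
have [y1|y1] := leP y%:E (vtx A (i + 1)).
  apply: (base i) => //; rewrite /seg ?ix ?y1 /= ?andbT.
    by rewrite (le_trans _ y1)// lee_fin.
  by rewrite (le_trans ix)// lee_fin.
have [x1|x1] := leP (vtx A (i + 1)) x%:E; first exact: (IH (i + 1)).
(* This vertex lies strictly between the reals [x] and [y], hence is finite. *)
have [c cE] : exists c, vtx A (i + 1) = c%:E.
  by move: x1 y1; case: (vtx A (i + 1)) => [c|//|//]; exists c.
have xc : x <= c by rewrite -lee_fin -cE ltW.
have cy : c <= y by rewrite -lee_fin -cE ltW.
apply: (tr _ c) => //.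
  apply: (base i) => //; rewrite /seg ?ix ?cE ?lee_fin ?xc//=.
  by rewrite lexx andbT (le_trans ix)// lee_fin.
by apply: (IH (i + 1)) => //; rewrite cE.
Qed.

(** [left_end d l p m]: the block [l, p] at the left of the core; it belongs to
    the support of the kernel if [d], and to that of the cokernel otherwise. *)
Definition left_end (d : bool) (l : \bar R) p m : Prop :=
  [/\ hasidx A m, hasidx A (m + 1), evenz m = d,
      (vtx A m <= p%:E < vtx A (m + 1))%E
    & l = p%:E /\ (vtx A m < p%:E)%E \/
      [/\ vtx A m = p%:E, hasidx A (m - 1) & l = vtx A (m - 1)]].

(** Segment [n] is the last one of the core. Its sink is on the side of [q] when [n] is odd, hence
    [~~ evenz n]; a nondegenerate block is the segment [n + 1]. *)
Definition right_end (d : bool) (r : \bar R) q n : Prop :=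
  [/\ hasidx A n, hasidx A (n + 1), ~~ evenz n = d,
      (vtx A n < q%:E <= vtx A (n + 1))%E
    & r = q%:E /\ (q%:E < vtx A (n + 1))%E \/
      [/\ vtx A (n + 1) = q%:E, hasidx A (n + 1 + 1) & r = vtx A (n + 1 + 1)]].

Lemma left_end_le d l p m : left_end d l p m -> (l <= p%:E)%E.
Proof.
move=> [hm _ _ _ [[->//]|[<- hm1 ->]]].
by apply: vtx_leq => //; lia.
Qed.

Lemma right_end_le d r q n : right_end d r q n -> (q%:E <= r)%E.
Proof.
move=> [_ hm _ _ [[->//]|[<- hm1 ->]]].
by apply: vtx_leq => //; lia.
Qed.

(** Points of []p, e]] are interior to segment [m], so every arrow touching them stays in it. A
    nondegenerate block is segment [m - 1], whose direction is opposite, so its arrows point to [p]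
    too. *)
Lemma left_endfacts d l p m e : left_end d l p m -> p < e ->
  (e%:E < vtx A (m + 1))%E ->
  endfacts (ordirect (prec A) d) (fun x => x <= e)
    (fun x => (l <= x%:E)%E && (x <= p)) (fun x => (p < x) && (x <= e)) p e.
Proof.
move=> lend pe em; have lp := left_end_le lend.
move: lend => [hm hm1 md /andP[mp pm] lE].
have segm x : p <= x -> x <= e -> seg m x.
  move=> px xe; rewrite /seg (le_trans mp) ?lee_fin//=.
  by rewrite (le_trans _ (ltW em)) ?lee_fin.
have ordm x y : seg m x -> seg m y -> ordirect (prec A) d y x <-> y <= x.
  by move=> sx sy; rewrite (ordirectE d hm hm1)// md eqxx.
have sp : seg m p by apply: segm => //; apply: ltW.
have se : seg m e by apply: segm => //; apply: ltW.
have intm x n : p < x -> x <= e -> hasidx A n -> hasidx A (n + 1) ->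
    seg n x -> n = m.
  move=> px xe hn hn1; apply: (seg_interior hm hm1) => //.
    by rewrite (le_lt_trans mp)// lte_fin.
  by rewrite (le_lt_trans _ em)// lee_fin.
have le_l x : p < x -> (l <= x%:E)%E.
  by move=> px; rewrite (le_trans lp)// lee_fin ltW.
split.
- by rewrite lp lexx/= ltW.
- by rewrite pe lexx.
- move=> x /andP[px xe]; have sx := segm x (ltW px) xe.
  by rewrite !ordm//; split=> //; apply: ltW.
- move=> x y /andP[px xe] ye yx.
  have [n [hn hn1 sx sy]] := ordirect_seg yx.
  move: (intm _ _ px xe hn hn1 sx) => nm; subst n.
  case: (ltP p y) => py; first by left; rewrite ye.
  by right; rewrite !ordm.
- move=> x y /andP[lx xp] /andP[py ye] yx.
  have [n [hn hn1 sx sy]] := ordirect_seg yx.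
  move: (intm _ _ py ye hn hn1 sy) => nm; subst n.
  by move: yx; rewrite ordm// leNgt (le_lt_trans xp py).
- move=> x /andP[lx xp]; case: lE => [[lE _]|[mE hm' lE]].
    have -> : x = p by apply/le_anti; rewrite xp -lee_fin -lE.
    by rewrite !ordm.
  have m1 : m - 1 + 1 = m by rewrite subrK.
  have hm1' : hasidx A (m - 1 + 1) by rewrite m1.
  have sx' : seg (m - 1) x by rewrite /seg m1 mE lee_fin xp -lE lx.
  have sp' : seg (m - 1) p by rewrite /seg m1 mE lexx -lE lp.
  have ev : evenz (m - 1) == d = false.
    by rewrite -md -{2}m1 evenzD1; case: (evenz _).
  by rewrite !(ordirectE d hm' hm1')// ev.
- move=> x y Jx ye xy.
  suff ly : (l <= y%:E)%E by rewrite ly ye /= !andbT; case: leP.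
  have [n [hn hn1 sy sx]] := ordirect_seg xy.
  have mm : n = m -> (l <= x%:E)%E -> (l <= y%:E)%E.
    move=> nm lx; subst n; move: xy; rewrite ordm// -lee_fin.
    exact: le_trans.
  case/orP: Jx => /andP[h1 h2]; last first.
    by apply: mm; [exact: (intm x) | exact: le_l].
  case: lE => [[lE mp']|[mE hm' lE]].
    apply: mm => //; apply: (seg_interior hm hm1) sx => //.
      by rewrite (lt_le_trans mp')// -lE.
    by rewrite (le_lt_trans _ pm)// lee_fin.
  have [nm|nm] := leP (m - 1) n.
    by rewrite lE (le_trans _ (proj1 (andP sy)))// vtx_leq.
  (* Remaining case: [n] is [m - 2] and [x] is the vertex [l], seen from the segment left of the
     block. That segment has the direction of segment [m], which gives [x <= y]. *)
  have := vtx_inj_le hm' hn1.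
  rewrite -lE (le_trans h1 (proj2 (andP sx))) => /(_ isT) nm'.
  have nE : m = n + 1 + 1 by clear -nm nm'; lia.
  move: xy; rewrite (ordirectE d hn hn1)// -md nE !evenzD1 negbK eqxx.
  by rewrite -lee_fin; apply: le_trans.
Qed.

(** Mirror image of [left_endfacts]. *)
Lemma right_endfacts d r q n f : right_end d r q n -> f < q ->
  (vtx A n < f%:E)%E ->
  endfacts (ordirect (prec A) d) (fun x => f <= x)
    (fun x => (q <= x) && (x%:E <= r)%E) (fun x => (f <= x) && (x < q)) q f.
Proof.
move=> rend fq nf; have qr := right_end_le rend.
move: rend => [hn hn1 nd /andP[nq qn] rE].
have nd' : evenz n == d = false by rewrite -nd; case: (evenz n).
have segn x : f <= x -> x <= q -> seg n x.
  move=> fx xq; rewrite /seg (le_trans (ltW nf)) ?lee_fin//=.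
  by rewrite (le_trans _ qn) ?lee_fin.
have ordn x y : seg n x -> seg n y -> ordirect (prec A) d y x <-> x <= y.
  by move=> sx sy; rewrite (ordirectE d hn hn1)// nd'.
have sq : seg n q by apply: segn => //; apply: ltW.
have sf : seg n f by apply: segn => //; apply: ltW.
have intn x m : f <= x -> x < q -> hasidx A m -> hasidx A (m + 1) ->
    seg m x -> m = n.
  move=> fx xq hm hm1; apply: (seg_interior hn hn1) => //.
    by rewrite (lt_le_trans nf)// lee_fin.
  by rewrite (lt_le_trans _ qn)// lte_fin.
have le_r x : x < q -> (x%:E <= r)%E.
  by move=> xq; rewrite (le_trans _ qr)// lee_fin ltW.
split.
- by rewrite qr lexx/= ltW.
- by rewrite fq lexx.
- move=> x /andP[fx xq]; have sx := segn x fx (ltW xq).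
  by rewrite !ordn//; split=> //; apply: ltW.
- move=> x y /andP[fx xq] fy yx.
  have [m [hm hm1 sx sy]] := ordirect_seg yx.
  move: (intn _ _ fx xq hm hm1 sx) => mn; subst m.
  case: (ltP y q) => yq; first by left; rewrite fy.
  by right; rewrite !ordn.
- move=> x y /andP[qx xr] /andP[fy yq] yx.
  have [m [hm hm1 sx sy]] := ordirect_seg yx.
  move: (intn _ _ fy yq hm hm1 sy) => mn; subst m.
  by move: yx; rewrite ordn// leNgt (lt_le_trans yq qx).
- move=> x /andP[qx xr]; case: rE => [[rE _]|[nE hn' rE]].
    have -> : x = q by apply/le_anti; rewrite qx -lee_fin -rE xr.
    by rewrite !ordn.
  have sx' : seg (n + 1) x by rewrite /seg nE lee_fin qx -rE xr.
  have sq' : seg (n + 1) q by rewrite /seg nE lexx -rE qr.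
  have ev : evenz (n + 1) == d by rewrite evenzD1 nd.
  by rewrite !(ordirectE d hn1 hn')// ev.
- move=> x y Jx fy xy.
  suff ry : (y%:E <= r)%E by rewrite ry fy /= andbT; case: leP.
  have [m [hm hm1 sy sx]] := ordirect_seg xy.
  have mm : m = n -> (x%:E <= r)%E -> (y%:E <= r)%E.
    move=> mn xr; subst m; move: xy; rewrite ordn// -lee_fin.
    by move=> yx; apply: le_trans xr.
  case/orP: Jx => /andP[h1 h2]; last first.
    by apply: mm; [exact: (intn x) | exact: le_r].
  case: rE => [[rE qn']|[nE hn' rE]].
    apply: mm => //; apply: (seg_interior hn hn1) sx => //.
      by rewrite (lt_le_trans nq)// lee_fin.
    by rewrite (le_lt_trans _ qn')// -rE.
  have [mn|mn] := leP m (n + 1).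
    rewrite rE (le_trans (proj2 (andP sy)))// vtx_leq//; clear -mn; lia.
  have := vtx_inj_le hm hn'.
  rewrite -rE (le_trans (proj1 (andP sx)) h2) => /(_ isT) nm'.
  have mE : m = n + 1 + 1 by clear -mn nm'; lia.
  move: xy; rewrite (ordirectE d hm hm1)// mE !evenzD1 negbK nd'.
  by rewrite -lee_fin => yx; apply: le_trans h2.
Qed.

End Segments.

(** P = [l, p] and Q = [q, r] are the blocks at the two ends of the core ]p, q[.
    With d, d' telling whether P, Q lie in the support of N, the supports of
    N, I1, I2, M are those of parameters (d, d'), (d, ~~ d'), (~~ d, d'),
    (~~ d, ~~ d'); this covers the 16 types. *)
Definition supp (R : realType) (l : \bar R) (p q : R) (r : \bar R)
    (a b : bool) (x : R) : bool :=
  [|| p < x < q, a && ((l <= x%:E)%E && (x <= p))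
    | b && ((q <= x) && (x%:E <= r)%E)].

Section SuppRegions.
Context {R : realType} {l : \bar R} {p q : R} {r : \bar R}.

Lemma supp_left (a b : bool) e x : e < q -> x <= e ->
  (p < x) && (x <= e) || a && ((l <= x%:E)%E && (x <= p)) = supp l p q r a b x.
Proof.
move=> eq xe; have xq := le_lt_trans xe eq.
by rewrite /supp xe xq (leNgt q) xq /= !andbF orbF.
Qed.

Lemma supp_right (a b : bool) f x : p < f -> f <= x ->
  (f <= x) && (x < q) || b && ((q <= x) && (x%:E <= r)%E) = supp l p q r a b x.
Proof.
move=> pf fx; have px := lt_le_trans pf fx.
by rewrite /supp fx px (leNgt x) px /= !andbF.
Qed.

Lemma supp_mid (a b : bool) x : p < x -> x < q -> supp l p q r a b x.
Proof. by rewrite /supp => -> ->. Qed.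

End SuppRegions.

(** * Splitting and extending families over both ends *)

Section EndsGlue.
Context {R : realType} {le : R -> R -> Prop} (Y : diagram le).
Hypothesis le_mid : forall x y c, le y x -> (x <= c <= y) || (y <= c <= x) ->
  le y c /\ le c x.
Variables (l : \bar R) (p q : R) (r : \bar R) (d d' : bool) (e f : R).
Hypotheses (pe : p < e) (ef : e <= f) (fq : f < q).
Hypothesis efl : endfacts (ordirect le d) (fun x => x <= e)
    (fun x => (l <= x%:E)%E && (x <= p)) (fun x => (p < x) && (x <= e)) p e.
Hypothesis efr : endfacts (ordirect le d') (fun x => f <= x)
    (fun x => (q <= x) && (x%:E <= r)%E) (fun x => (f <= x) && (x < q)) q f.

Notation S := (supp l p q r).
Let eq : e < q := le_lt_trans ef fq.
Let pf : p < f := lt_le_trans pe ef.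

Lemma family_glue3 (a b : bool) (t1 t2 t3 : forall x, Y x) :
  family_on Y (fun x => x <= e)
    (fun x => (p < x) && (x <= e) || a && ((l <= x%:E)%E && (x <= p))) t1 ->
  family_on Y (fun x => e <= x <= f) predT t2 ->
  family_on Y (fun x => f <= x)
    (fun x => (f <= x) && (x < q) || b && ((q <= x) && (x%:E <= r)%E)) t3 ->
  t1 e = t2 e -> t2 f = t3 f ->
  family_on Y (fun=> True) (S a b)
    (fun x => if x <= e then t1 x else if x <= f then t2 x else t3 x).
Proof.
move=> h1 h2 h3 e12 e23.
apply: (family_glue le_mid) => //; first by rewrite supp_mid// (lt_le_trans pe).
- by rewrite ef.
- apply: (family_on_eq (J := fun x =>
    (p < x) && (x <= e) || a && ((l <= x%:E)%E && (x <= p)))).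
    by move=> x [_ xe]; rewrite -(supp_left _ _ eq).
  by apply: family_on_sub h1 => x [].
apply: (family_glue le_mid) => //.
- exact: supp_mid.
- apply: (family_on_eq (J := predT)).
    move=> x [[_ ex] xf]; rewrite supp_mid//; first exact: lt_le_trans ex.
    exact: le_lt_trans fq.
  by apply: family_on_sub h2 => x [[_ ->] ->].
apply: (family_on_eq (J := fun x =>
    (f <= x) && (x < q) || b && ((q <= x) && (x%:E <= r)%E))).
  by move=> x [_ fx]; rewrite -(supp_right _ _ pf).
by apply: family_on_sub h3 => x [].
Qed.

(** Reversing all arrows exchanges the roles of N and M and of I1 and I2, so
    that this applies both to vectors (with t a map out of N) and, for the dual
    spaces, to functionals (with t a map into M). *)
Lemma family_split (t tau : forall x, Y x) :
  family_on Y (fun=> True) (S d d') t ->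
  family_on Y (fun x => e <= x <= f) predT tau ->
  admissible Y d p (t e - tau e) -> admissible Y d' q (tau f) ->
  exists t1 t2 : forall x, Y x,
    [/\ family_on Y (fun=> True) (S d (~~ d')) t1,
        family_on Y (fun=> True) (S (~~ d) d') t2
      & forall x, S d d' x -> t x = t1 x + t2 x].
Proof.
move=> ht htau al ar.
have htl : family_on Y (fun x => x <= e)
    (fun x => (p < x) && (x <= e) || d && ((l <= x%:E)%E && (x <= p))) t.
  apply: (family_on_eq (J := S d d')).
    by move=> x xe; rewrite -(supp_left _ _ eq).
  exact: family_on_sub ht.
have htr : family_on Y (fun x => f <= x)
    (fun x => (f <= x) && (x < q) || d' && ((q <= x) && (x%:E <= r)%E)) t.
  apply: (family_on_eq (J := S d d')).
    by move=> x xf; rewrite -(supp_right _ _ pf).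
  exact: family_on_sub ht.
have htm : family_on Y (fun x => e <= x <= f) predT t.
  apply: (family_on_eq (J := S d d')).
    move=> x /andP[ex xf]; rewrite supp_mid//; first exact: lt_le_trans ex.
    exact: le_lt_trans fq.
  exact: family_on_sub ht.
have [tn [tm [ln lm lme lne lE]]] := end_split efl htl al.
have [tn' [tm' [rn rm rmf rnf rE]]] := end_split efr htr ar.
(* The corrections are [t e - tau e] on the left and [tau f] on the right, so [tn e = tau e] and
   [tm' f = tau f]: [tau] joins the N part of the left end to the M part of the right end, which is
   the support of I1. The rest, with [t - tau] in the middle, has the support of I2. *)
exists (fun x => if x <= e then tn x else if x <= f then tau x else tm' x).
exists (fun x => if x <= e then tm x else if x <= f then t x - tau x else tn' x).
split.
- by apply: family_glue3 => //; rewrite lne subKr.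
- by apply: family_glue3 => //; exact: family_onB.
move=> x Sx; case: ifPn => [xe|]; first by apply: lE => //; rewrite (supp_left (r := r) _ d' eq).
rewrite -ltNge => ex; case: ifPn => [xf|]; first by rewrite addrC subrK.
rewrite -ltNge => /ltW fx; rewrite addrC; apply: rE => //.
by rewrite (supp_right (l := l) d _ pf).
Qed.

(** Applied to the zero family, [end_split] just extends an admissible value over an end. *)
Lemma family_extends (tau : forall x, Y x) :
  family_on Y (fun x => e <= x <= f) predT tau ->
  admissible Y d p (tau e) -> admissible Y d' q (tau f) ->
  exists2 m : forall x, Y x,
    family_on Y (fun=> True) (S (~~ d) (~~ d')) m & m e = tau e.
Proof.
move=> htau al ar.
have h0 D J : family_on Y D J (fun=> 0).
  by split=> // x y _ _ _ _; rewrite act0.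
have [tn [tm [_ lm lme _ _]]] := end_split efl (h0 _ _) al.
have [tn' [tm' [_ rm rmf _ _]]] := end_split efr (h0 _ _) ar.
exists (fun x => if x <= e then tm x else if x <= f then tau x else tm' x).
  exact: family_glue3.
by rewrite lexx.
Qed.

End EndsGlue.

(** * Families of vectors and of functionals of a representation; duality along the core *)

Section RepDiagram.
Context {R : realType} {k : fieldType} {A : cquiver R}.
Variable X : rep k A.

(** Made total, with value 0 off the arrows, to get rid of the proof argument of [rep_map]. *)
Definition trans (x y : R) : {linear X x -> X y} :=
  match pselect (prec A y x) with
  | left h => rep_map X h
  | right _ => \0
  end.

Lemma transE x y (h : prec A y x) v : trans x y v = rep_map X h v.
Proof.
by rewrite /trans; case: pselect => // h'; rewrite (Prop_irrelevance h' h).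
Qed.

Lemma trans_id x v : prec A x x -> trans x x v = v.
Proof. by move=> h; rewrite transE rep_map_id. Qed.

Lemma trans_comp x y z v : prec A y x -> prec A z y -> prec A z x ->
  trans x z v = trans y z (trans x y v).
Proof. by move=> h1 h2 h3; rewrite !transE (rep_map_comp h1 h2 h3). Qed.

Definition rep_diagram : diagram (prec A).
Proof.
refine (@Diagram _ _ (fun x => X x : zmodType) (fun x y => trans x y) _ _ _).
- by move=> x y u v; rewrite linearB.
- by move=> x u /trans_id.
- by move=> x y z u; apply: trans_comp.
Defined.

Definition dual_diagram : diagram (fun y x => prec A x y).
Proof.
refine (@Diagram _ (fun y x => prec A x y) (fun x => dual (X x) : zmodType)
  (fun x y => dual_comp (trans y x)) _ _ _).
- by move=> x y u v; apply: dualP.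
- by move=> x u h; apply: dualP => v /=; rewrite /dual_fun /= trans_id.
- move=> x y z u h1 h2 h3; apply: dualP => v; rewrite /dual_fun /=.
  by rewrite (trans_comp _ h2 h1 h3).
Defined.

Lemma rep_family_lin D J (a : k) (t t' : forall x, X x) :
  family_on rep_diagram D J t -> family_on rep_diagram D J t' ->
  family_on rep_diagram D J (fun x => a *: t x + t' x).
Proof.
move=> [h0 h] [h0' h']; split=> [x Dx Jx|x y Dx Dy Jx yx].
  by rewrite h0// h0'// scaler0 addr0.
by rewrite -(h x y)// -(h' x y)//= linearP.
Qed.

Lemma rep_family0 D J : family_on rep_diagram D J (fun=> 0).
Proof. by split=> // x y _ _ _ _ /=; rewrite linear0. Qed.

Lemma admissible_subspace d p e :
  subspace (fun v : X e => admissible rep_diagram d p v).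
Proof.
rewrite /admissible; case: d; split=> /=; first exact: linear0.
- by move=> a u v hu hv; rewrite linearP hu hv scaler0 addr0.
- by exists 0; rewrite linear0.
- by move=> a _ _ [u ->] [v ->]; exists (a *: u + v); rewrite linearP.
Qed.

Hypothesis Xfd : pointwise_fd X.

Lemma pointwise_fingen x : fingen (X x).
Proof.
have [n [b hb]] := Xfd x; exists [seq b i | i : 'I_n] => W hW sub v.
have [c ->] := hb v; apply: big_ind => [|u w|i _]; first by case: hW.
  exact: subspaceD.
by apply: subspaceZ => //; apply: sub; apply: map_f; rewrite mem_enum.
Qed.

(** The annihilator of a kernel is the image of the transpose, and that of an image is the kernel of
    the transpose. In the first case [phi] descends to the image of [trans e p] and is extended from
    there to [X p]. *)
Lemma dual_admissible d p e (phi : dual (X e)) :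
  (forall v, admissible rep_diagram d p v -> phi v = 0) ->
  admissible dual_diagram (~~ d) p phi.
Proof.
case: d => /= h; last first.
  by apply: dualP => v; rewrite /dual_fun /=; apply: h; exists v.
pose G (z : X p * k^o) := exists v, z = (trans e p v, phi v).
have [||f fP] := @linear_relation_extends _ _ G (pointwise_fingen p).
- split; first by exists 0; rewrite linear0 dual0.
  move=> a _ _ [u ->] [v ->]; exists (a *: u + v).
  by apply: injective_projections; rewrite /= ?linearP ?dual_lin.
- by move=> c [v [v0 ->]]; apply: h; rewrite /= -v0.
exists f; apply: dualP => v; rewrite {2}/dual_fun /=.
by rewrite -[LHS](fP (trans e p v))//; exists v.
Qed.

(** For compatible [eta] and [t], the scalar [eta z (t z)] does not depend on [z], so the agreement
    of [phi] and [psi] is a necessary condition for them to be the ends of a family of functionals.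
    The property says that it is sufficient. *)
Definition zigzag (x y : R) : Prop :=
  forall (phi : dual (X x)) (psi : dual (X y)),
  (forall t, family_on rep_diagram (fun z => x <= z <= y) predT t ->
     phi (t x) = psi (t y)) ->
  exists eta : forall z, dual (X z),
    [/\ family_on dual_diagram (fun z => x <= z <= y) predT eta,
        eta x = phi & eta y = psi].

(** [D] has a greatest point [a] and a least point [b]: vectors are transported from [a],
    functionals are pulled back from [b], and the hypothesis says that [phi] is the pullback of
    [psi]. *)
Lemma zigzag_monotone (D : R -> Prop) a b (phi : dual (X a))
    (psi : dual (X b)) :
  D a -> D b -> (forall z, D z -> prec A z a /\ prec A b z) ->
  (forall t, family_on rep_diagram D predT t -> phi (t a) = psi (t b)) ->
  exists eta : forall z, dual (X z),
    [/\ family_on dual_diagram D predT eta, eta a = phi & eta b = psi].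
Proof.
move=> Da Db hD h; have [aa ba] := hD _ Da; have [_ bb] := hD _ Db.
exists (fun z => dual_comp (trans z b) psi); split.
- split=> // x y Dx Dy _ xy; apply: dualP => v; rewrite /dual_fun /=.
  by rewrite (trans_comp _ xy (hD _ Dx).2 (hD _ Dy).2).
- apply: dualP => v; rewrite {1}/dual_fun /=.
  rewrite -(h (fun z => trans a z v)) ?trans_id//.
  split=> // x y Dx Dy _ yx /=.
  by rewrite (trans_comp _ (hD _ Dx).1 yx (hD _ Dy).1).
- by apply: dualP => v; rewrite {1}/dual_fun /= trans_id.
Qed.

(** A functional [chi] at [y] is wanted that matches [phi] on families over [[x, y]] and [psi] on
    families over [[y, z]]. It is prescribed on the sums [t y + t' y]; when such a sum vanishes, [t]
    and [-t'] glue to a family on [[x, z]], and the hypothesis gives the value 0. *)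
Lemma zigzag_trans x y z : x <= y -> y <= z -> zigzag x y -> zigzag y z ->
  zigzag x z.
Proof.
move=> xy yz hxy hyz phi psi h.
have mid := @prec_mid _ A.
have glue (t t' : forall x, X x) : t y = t' y ->
    family_on rep_diagram (fun w => x <= w <= y) predT t ->
    family_on rep_diagram (fun w => y <= w <= z) predT t' ->
    phi (t x) = psi (t' z).
  move=> e ht ht'.
  have fam : family_on rep_diagram (fun w => x <= w <= z) predT
      (fun w => if w <= y then t w else t' w).
    apply: (family_glue (Y := rep_diagram) mid) => //.
    - by rewrite xy.
    - by apply: family_on_sub ht => w [/andP[-> _] ->].
    - by apply: family_on_sub ht' => w [/andP[_ ->] ->].
  have := h _ fam; rewrite xy; case: leP => // zy.
  have zE : z = y by apply/le_anti; rewrite zy yz.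
  by subst z; rewrite -e.
pose G (v : X y * k^o) := exists t t',
  [/\ family_on rep_diagram (fun w => x <= w <= y) predT t,
      family_on rep_diagram (fun w => y <= w <= z) predT t'
    & v = (t y + t' y, phi (t x) + psi (t' z))].
have [||chi hchi] := @linear_relation_extends _ _ G (pointwise_fingen y).
- split.
    exists (fun=> 0), (fun=> 0); split; [exact: rep_family0..|].
    by rewrite !dual0 !addr0.
  move=> a _ _ [t [t' [ht ht' ->]]] [s [s' [hs hs' ->]]].
  exists (fun w => a *: t w + s w), (fun w => a *: t' w + s' w).
  split; [exact: rep_family_lin..|].
  by apply: injective_projections; rewrite /= ?scalerDr ?dual_lin addrACA.
- move=> c [t [t' [ht ht' [e ->]]]].
  have e' : t y = -1 *: t' y + 0.
    by rewrite scaleN1r addr0; apply/eqP; rewrite -addr_eq0 -e.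
  have := glue t (fun w => -1 *: t' w + 0) e' ht
    (rep_family_lin (-1) ht' (rep_family0 _ _)).
  by rewrite dual_lin dual0 addr0 mulN1r => ->; rewrite addNr.
have [|eta1 [f1 e1 e1']] := hxy phi chi.
  move=> t ht; apply/esym/hchi; exists t, (fun=> 0); split=> //.
    exact: rep_family0.
  by rewrite dual0 !addr0.
have [|eta2 [f2 e2 e2']] := hyz chi psi.
  move=> t ht; apply/hchi; exists (fun=> 0), t; split=> //.
    exact: rep_family0.
  by rewrite dual0 !add0r.
exists (fun w => if w <= y then eta1 w else eta2 w); split.
- apply: (family_glue (Y := dual_diagram)) => //.
  + move=> u v c vu hc; have [] := mid _ _ c vu; last by [].
    by rewrite orbC.
  + by rewrite xy.
  + by rewrite e1' e2.
  + by apply: family_on_sub f1 => w [/andP[-> _] ->].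
  + by apply: family_on_sub f2 => w [/andP[_ ->] ->].
- by rewrite xy.
- case: leP => // zy; have zE : z = y by apply/le_anti; rewrite zy yz.
  by subst z; rewrite e1' -e2 e2'.
Qed.

(** Inside one segment the ends of [[x, y]] are its greatest and least points for the order of the
    quiver, in the order fixed by parity. *)
Lemma zigzagP i j x y : hasidx A i -> hasidx A j -> i < j ->
  (vtx A i <= x%:E)%E -> x <= y -> (y%:E <= vtx A j)%E -> zigzag x y.
Proof.
move=> hi hj ij; move: x y; apply: (chain_ind hi hj ij); last exact: zigzag_trans.
move=> n x y hn hn1 sx sy xy phi psi h.
have sz z : x <= z <= y -> seg A n z.
  move=> /andP[xz zy]; case/andP: sx sy => nx _ /andP[_ yn].
  by rewrite /seg (le_trans nx) ?lee_fin//= (le_trans _ yn) ?lee_fin.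
have xx : x <= x <= y by rewrite lexx.
have yy : x <= y <= y by rewrite lexx andbT.
case: (boolP (evenz n)) => ev.
  have [||eta [h1 h2 h3]] := @zigzag_monotone (fun z => x <= z <= y) y x psi phi yy xx.
  - by move=> z hz; rewrite !(precE hn hn1) ?ev ?sz//; case/andP: hz.
  - by move=> t /h.
  - by exists eta.
have [||eta [h1 h2 h3]] := @zigzag_monotone (fun z => x <= z <= y) x y phi psi xx yy.
- by move=> z hz; rewrite !(precE hn hn1) ?(negbTE ev) ?sz//; case/andP: hz.
- by move=> t /h.
- by exists eta.
Qed.

Section Dichotomies.
Variables (e f : R) (Ke : X e -> Prop) (Kf : X f -> Prop).
Hypotheses (zef : zigzag e f) (hKe : subspace Ke) (hKf : subspace Kf).

Let Vfg : fingen (X e * X f)%type :=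
  fingen_prod (pointwise_fingen e) (pointwise_fingen f).

(** The two components of [L] are fed to [zef]; the minus sign turns the vanishing of [L] on end
    values into an equality. *)
Let subvec (L : dual (X e * X f)%type) :
  (forall t, family_on rep_diagram (fun z => e <= z <= f) predT t ->
     L (t e, t f) = 0) ->
  exists eta : forall z, dual (X z),
    [/\ family_on dual_diagram (fun z => e <= z <= f) predT eta,
        forall v, eta e v = L (v, 0) & forall v, eta f v = - L (0, v)].
Proof.
move=> hL.
have l1 : linear_for *%R (fun v => L (v, 0)).
  move=> a u v; rewrite -dual_lin; congr (dual_fun L _).
  by apply: injective_projections; rewrite /= ?scaler0 ?addr0.
have l2 : linear_for *%R (fun v => - L (0, v)).
  move=> a u v; rewrite mulrN -opprD -dual_lin; congr (- dual_fun L _).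
  by apply: injective_projections; rewrite /= ?scaler0 ?addr0.
have [|eta [h1 h2 h3]] := zef (phi := exist _ _ l1) (psi := exist _ _ l2).
  move=> t ht; rewrite /dual_fun /=; apply/eqP; rewrite -addr_eq0 -dualD.
  rewrite -(hL _ ht); apply/eqP; congr (dual_fun L _).
  by apply: injective_projections; rewrite /= ?add0r ?addr0.
by exists eta; split=> // v; rewrite ?h2 ?h3.
Qed.

(** The functional sought on [X e * X f] vanishes on the end values of families and on [Ke] and
    [Kf], and is 1 at [(u, 0)]. This prescription is contradictory only if [(u, 0)] is a sum of such
    vectors, which is the first alternative. *)
Lemma vector_dichotomy (u : X e) :
  (exists t, [/\ family_on rep_diagram (fun z => e <= z <= f) predT t,
     Ke (u - t e) & Kf (t f)]) \/
  (exists eta : forall z, dual (X z),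
    [/\ family_on dual_diagram (fun z => e <= z <= f) predT eta,
        forall v, Ke v -> eta e v = 0, forall v, Kf v -> eta f v = 0
      & eta e u = 1]).
Proof.
rewrite -implyNp => nt.
pose G (z : (X e * X f) * k^o) := exists t v w,
  [/\ family_on rep_diagram (fun z => e <= z <= f) predT t, Ke v, Kf w
    & z.1 = (t e + v + (z.2 : k) *: u, t f + w)].
have [||L hL] := @linear_relation_extends _ _ G Vfg.
- split.
    exists (fun=> 0), 0, 0; split; [exact: rep_family0 | by case: hKe
      | by case: hKf |].
    by rewrite scale0r !addr0.
  move=> a [z1 c1] [z2 c2] [t [v [w [ht hv hw /= ->]]]] [s [v' [w' [hs hv' hw' /= ->]]]].
  exists (fun x => a *: t x + s x), (a *: v + v'), (a *: w + w').
  split; [exact: rep_family_lin | by case: hKe => _; apply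
    | by case: hKf => _; apply |].
  have cE : (a * c1 + c2) *: u = a *: (c1 *: u) + c2 *: u.
    by rewrite scalerDl scalerA.
  apply: injective_projections => /=; last by rewrite !scalerDr addrACA.
  rewrite [X in _ = _ + X]cE !scalerDr.
  by rewrite [LHS](AC (3*3) ((1*4)*(2*5)*(3*6))).
- move=> c [t [v [w [ht hv hw [e1 e2]]]]]; apply: contrapT => /eqP c0.
  (* Dividing the relation by [c] solves it for [u]. The added 0 is the shape produced by
     [rep_family_lin]. *)
  apply: nt; exists (fun x => - c^-1 *: t x + 0); split.
  + exact: rep_family_lin (rep_family0 _ _).
  + have -> : u - (- c^-1 *: t e + 0) = - c^-1 *: v.
      have cu : c *: u = - (t e + v) by apply/eqP; rewrite -addr_eq0 addrC -e1.
      rewrite addr0 -[u](scalerK c0) cu scalerN scalerDr !scaleNr opprK opprD.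
      by rewrite addrAC addNr add0r.
    exact: subspaceZ.
  + have -> : - c^-1 *: t f + 0 = c^-1 *: w.
      have tw : t f = - w by apply/eqP; rewrite -addr_eq0 -e2.
      by rewrite addr0 tw scalerN scaleNr opprK.
    exact: subspaceZ.
have [t ht|eta [h1 h2 h3]] := subvec (L := L).
  apply: hL; exists t, 0, 0; split=> //; [by case: hKe | by case: hKf|].
  by rewrite /= scale0r !addr0.
exists eta; split=> //.
- move=> v hv; rewrite h2; apply: hL; exists (fun=> 0), v, 0.
  split=> //; [exact: rep_family0 | by case: hKf |].
  by rewrite /= scale0r !addr0 add0r.
- move=> v hv; rewrite h3 (hL (0, v) 0) ?oppr0//; exists (fun=> 0), 0, v.
  split=> //; [exact: rep_family0 | by case: hKe |].
  by rewrite /= scale0r !addr0 add0r.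
- rewrite h2; apply: hL; exists (fun=> 0), 0, 0.
  split=> //; [exact: rep_family0 | by case: hKe | by case: hKf |].
  by rewrite /= scale1r !addr0 add0r.
Qed.

(** The functional on [X e * X f] is now prescribed as [h0] on [Ke] and as 0 on [Kf] and on end
    values; a contradiction is a family that ends in [Ke] and [Kf] and on which [h0] is nonzero. *)
Lemma functional_dichotomy (h0 : dual (X e)) :
  (exists eta : forall z, dual (X z),
    [/\ family_on dual_diagram (fun z => e <= z <= f) predT eta,
        forall v, Ke v -> eta e v = h0 v & forall v, Kf v -> eta f v = 0]) \/
  (exists t, [/\ family_on rep_diagram (fun z => e <= z <= f) predT t,
     Ke (t e), Kf (t f) & h0 (t e) <> 0]).
Proof.
rewrite orC; rewrite -implyNp => nt.
pose G (z : (X e * X f) * k^o) := exists t v w,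
  [/\ family_on rep_diagram (fun z => e <= z <= f) predT t, Ke v, Kf w
    & z = (t e + v, t f + w, h0 v)].
have [||L hL] := @linear_relation_extends _ _ G Vfg.
- split.
    exists (fun=> 0), 0, 0; split; [exact: rep_family0 | by case: hKe
      | by case: hKf |].
    by rewrite !addr0 dual0.
  move=> a _ _ [t [v [w [ht hv hw /= ->]]]] [s [v' [w' [hs hv' hw' /= ->]]]].
  exists (fun x => a *: t x + s x), (a *: v + v'), (a *: w + w').
  split; [exact: rep_family_lin | by case: hKe => _; apply
    | by case: hKf => _; apply |].
  apply: injective_projections; last by rewrite /= dual_lin.
  by apply: injective_projections; rewrite /= !scalerDr addrACA.
- move=> c [t [v [w [ht hv hw [e1 e2 ->]]]]]; apply: contrapT => c0.
  have tv : t e = - v by apply/eqP; rewrite -addr_eq0 -e1.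
  have tw : t f = - w by apply/eqP; rewrite -addr_eq0 -e2.
  apply: nt; exists t; split=> //; rewrite ?tv ?tw.
  + exact: subspaceN.
  + exact: subspaceN.
  + by rewrite dualN => /eqP; rewrite oppr_eq0 => /eqP.
have [t ht|eta [h1 h2 h3]] := subvec (L := L).
  apply: hL; exists t, 0, 0; split=> //; [by case: hKe | by case: hKf|].
  by rewrite dual0 !addr0.
exists eta; split=> //.
- move=> v hv; rewrite h2; apply: hL; exists (fun=> 0), v, 0.
  split=> //; [exact: rep_family0 | by case: hKf |].
  by rewrite !addr0 add0r.
- move=> v hv; rewrite h3 (hL (0, v) 0) ?oppr0//; exists (fun=> 0), 0, v.
  split=> //; [exact: rep_family0 | by case: hKe |].
  by rewrite dual0 !addr0 add0r.
Qed.

End Dichotomies.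
End RepDiagram.

(** * Coordinates on k^0 and k^1; morphisms out of and into interval representations *)

Section Lines.
Context {k : fieldType}.

(** The coordinate of a vector of k^1, and 0 on k^0. *)
Definition coord {b : bool} (v : 'rV[k]_b) : k := \sum_i v 0 i.

Lemma coord_lin (b : bool) : linear_for *%R (@coord b).
Proof.
move=> a u v; rewrite /coord mulr_sumr -big_split /=.
by apply: eq_bigr => i _; rewrite !mxE.
Qed.

Lemma onesE (b c : bool) (v : 'rV[k]_b) : ones k b c v = coord v *: const_mx 1.
Proof.
apply/matrixP => i j; rewrite !ord1 !mxE mulr1.
by apply: eq_bigr => h _; rewrite mxE mulr1.
Qed.

Lemma coord_const (a : k) (b : bool) : coord (const_mx a : 'rV[k]_b) = b%:R * a.
Proof.
rewrite /coord (eq_bigr (fun=> a)) => [|i _]; last by rewrite mxE.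
by rewrite sumr_const card_ord mulr_natl.
Qed.

Lemma coordZ1 (b : bool) (a : k) : coord (a *: const_mx 1 : 'rV[k]_b) = b%:R * a.
Proof.
have -> : a *: const_mx 1 = const_mx a :> 'rV[k]_b.
  by apply/matrixP => i j; rewrite !mxE mulr1.
exact: coord_const.
Qed.

Lemma coordZ1_in (b : bool) (a : k) : b ->
  coord (a *: const_mx 1 : 'rV[k]_b) = a.
Proof. by rewrite coordZ1 => ->; rewrite mul1r. Qed.

Lemma coordK (b : bool) (v : 'rV[k]_b) : coord v *: const_mx 1 = v.
Proof. by rewrite -onesE ones_id. Qed.

Lemma coord_out (b : bool) (v : 'rV[k]_b) : ~~ b -> coord v = 0.
Proof. by case: b v => // v _; rewrite /coord big_ord0. Qed.

Lemma coord_ones (b c : bool) (v : 'rV[k]_b) : coord (ones k b c v) = c%:R * coord v.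
Proof. by rewrite onesE coordZ1. Qed.

End Lines.

Section Morphisms.
Context {R : realType} {k : fieldType} {A : cquiver R}.
Implicit Types (X V W : rep k A) (J : interval (\bar R)).

Lemma coord_notin J x (v : Mint k A J x) : x%:E \notin J -> @coord k (x%:E \in J) v = 0.
Proof. exact: coord_out. Qed.

Definition linear_of {U V : lmodType k} (f : U -> V) (h : linear f) :
  {linear U -> V} := HB.pack f (GRing.isLinear.Build k U V _ f h).

Definition hom_from X J (t : forall x, X x) : fam (Mint k A J) X.
Proof.
move=> x; apply: (@linear_of (Mint k A J x) (X x) (fun v => @coord k (x%:E \in J) v *: t x)).
by move=> a u v; rewrite coord_lin scalerDl scalerA.
Defined.

Lemma hom_from_natural X J (t : forall x, X x) :
  family_on (rep_diagram X) (fun=> True) (fun x => x%:E \in J) t ->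
  natural (@hom_from X J t).
Proof.
move=> [t0 tc] x y h v; rewrite /= -/(ones k _ _ _) linearZ/=.
have -> : coord (v *m const_mx 1 : 'rV[k]_(y%:E \in J)) =
    (y%:E \in J)%:R * @coord k (x%:E \in J) v.
  exact: coord_ones.
have [xJ|xJ] := orP (orbN (x%:E \in J)); last first.
  by rewrite (coord_notin _ xJ) mulr0 !scale0r.
have -> : rep_map X h (t x) = t y by rewrite -(transE h); apply: tc.
have [yJ|yJ] := orP (orbN (y%:E \in J)).
  by rewrite yJ mul1r.
by rewrite t0// !scaler0.
Qed.

Lemma hom_from_family X J (f : fam (Mint k A J) X) : natural f ->
  family_on (rep_diagram X) (fun=> True) (fun x => x%:E \in J)
    (fun x => f x (const_mx 1)).
Proof.
move=> nf; split=> [x _ xJ|x y _ _ xJ yx /=].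
  have -> : const_mx 1 = 0 :> Mint k A J x; last exact: linear0.
  by rewrite -[LHS]coordK (coord_notin _ xJ) scale0r.
rewrite (transE yx) nf; congr (f y _).
rewrite [LHS](onesE _ (const_mx 1 : 'rV[k]_(x%:E \in J))) coord_const xJ.
by rewrite mul1r scale1r.
Qed.

Lemma hom_fromE X J (f : fam (Mint k A J) X) x v :
  f x v = @coord k (x%:E \in J) v *: f x (const_mx 1).
Proof. by rewrite -linearZ; congr (f x _); rewrite /= coordK. Qed.

Definition hom_to X J (eta : forall x, dual (X x)) : fam X (Mint k A J).
Proof.
move=> x; apply: (@linear_of (X x) (Mint k A J x)
  (fun v => eta x v *: (const_mx 1 : 'rV[k]_(x%:E \in J)))).
by move=> a u v; rewrite dual_lin scalerDl scalerA.
Defined.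

Lemma Mint_out J x (v w : Mint k A J x) : x%:E \notin J -> v = w.
Proof.
move=> xJ; rewrite -(coordK (v : 'rV_(x%:E \in J))) -[RHS](coordK (w : 'rV_(x%:E \in J))).
by rewrite !(coord_notin _ xJ).
Qed.

Lemma hom_to_natural X J (eta : forall x, dual (X x)) :
  family_on (dual_diagram X) (fun=> True) (fun x => x%:E \in J) eta ->
  natural (@hom_to X J eta).
Proof.
move=> [t0 tc] x y h v.
have [yJ|yJ] := orP (orbN (y%:E \in J)); last exact: Mint_out.
have e : eta y (trans X x y v) = eta x v by rewrite -(tc y x I I yJ h).
rewrite /= -(transE h) e; have [xJ|xJ] := orP (orbN (x%:E \in J)); last first.
  by rewrite t0// dual_zeroE !scale0r mul0mx.
rewrite -[LHS]/(ones k (x%:E \in J) (y%:E \in J) (eta x v *: const_mx 1)).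
by rewrite onesE coordZ1 xJ mul1r.
Qed.

Definition hom_to_coord X J (f : fam X (Mint k A J)) x : dual (X x).
Proof.
exists (fun v => @coord k (x%:E \in J) (f x v)) => a u v.
by rewrite linearP /= coord_lin.
Defined.

Lemma hom_to_family X J (f : fam X (Mint k A J)) : natural f ->
  family_on (dual_diagram X) (fun=> True) (fun x => x%:E \in J)
    (hom_to_coord f).
Proof.
move=> nf; split=> [x _ xJ|y x _ _ yJ yx /=].
  by apply: dualP => v; rewrite /dual_fun /= (coord_notin _ xJ).
apply: dualP => v; rewrite /dual_fun /= (transE yx) -nf.
rewrite -[LHS]/(coord (ones k (x%:E \in J) (y%:E \in J) (f x v))).
by rewrite coord_ones yJ mul1r.
Qed.

Definition fam_comp X V W (f : fam X V) (g : fam V W) : fam X W.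
Proof.
move=> x; apply: (@linear_of (X x) (W x) (fun v => g x (f x v))).
by move=> a u v; rewrite !linearP.
Defined.

Lemma fam_comp_natural X V W (f : fam X V) (g : fam V W) :
  natural f -> natural g -> natural (fam_comp f g).
Proof. by move=> nf ng x y h v; rewrite /= ng nf. Qed.

Definition fam_pair X V W (f : fam X V) (g : fam X W) : fam X (rep_sum V W).
Proof.
move=> x; apply: (@linear_of (X x) (rep_sum V W x) (fun v => (f x v, g x v))).
by move=> a u v; rewrite !linearP.
Defined.

Lemma fam_pair_natural X V W (f : fam X V) (g : fam X W) :
  natural f -> natural g -> natural (fam_pair f g).
Proof. by move=> nf ng x y h v; rewrite /= /sum_map /= nf ng. Qed.

Definition fam_copair X V W (f : fam V X) (g : fam W X) : fam (rep_sum V W) X.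
Proof.
move=> x; apply: (@linear_of (rep_sum V W x) (X x)
  (fun u => f x u.1 + g x u.2)).
by move=> a u v; rewrite /= !linearP scalerDr addrACA.
Defined.

Lemma fam_copair_natural X V W (f : fam V X) (g : fam W X) :
  natural f -> natural g -> natural (fam_copair f g).
Proof. by move=> nf ng x y h v; rewrite /= linearD nf ng. Qed.

End Morphisms.

(** * Kernels of morphisms and split maps *)

Section Kernel.
Context {k : fieldType} {V W : lmodType k}.
Variable f : {linear V -> W}.

Definition kerpred : {pred V} := fun v => f v == 0.

Lemma kerpred_submod : submod_closed kerpred.
Proof.
split=> [|a u v]; rewrite !unfold_in ?linear0//.
by rewrite linearP => /eqP-> /eqP->; rewrite scaler0 addr0.
Qed.

HB.instance Definition _ := GRing.isSubmodClosed.Build k V kerpred kerpred_submod.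

Record ker_of := KerOf { ker_val :> V; ker_valP : ker_val \in kerpred }.
HB.instance Definition _ := [isSub for ker_val].
HB.instance Definition _ := [Choice of ker_of by <:].
HB.instance Definition _ := [SubChoice_isSubLmodule of ker_of by <:].

Lemma ker_val_inj : injective ker_val.
Proof. exact: val_inj. Qed.

Lemma ker_val_lin a (u v : ker_of) :
  ker_val (a *: u + v) = a *: ker_val u + ker_val v.
Proof. by []. Qed.

End Kernel.

Section KernelRep.
Context {R : realType} {k : fieldType} {A : cquiver R}.
Variables (X V : rep k A) (r : fam X V).
Hypothesis nr : natural r.

Let kmap x y (h : prec A y x) (u : ker_of (r x)) : ker_of (r y).
Proof.
exists (rep_map X h (ker_val u)).
abstract (by rewrite unfold_in -nr; have := ker_valP u; rewrite unfold_in => /eqP->;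
  rewrite linear0).
Defined.

Let kmap_lin x y (h : prec A y x) : linear (kmap h).
Proof. by move=> a u v; apply: ker_val_inj; rewrite ker_val_lin /= linearP. Qed.

Definition ker_rep : rep k A.
Proof.
refine (@Rep R k A (fun x => ker_of (r x) : lmodType k)
  (fun x y h => linear_of (kmap_lin h)) _ _).
- by move=> x h v; apply: ker_val_inj; rewrite /= rep_map_id.
- by move=> x y z h1 h2 h3 v; apply: ker_val_inj; rewrite /= (rep_map_comp h1 h2 h3).
Defined.

(** [v] goes to the pair of [r v] and [v - s (r v)], which identifies [X] with the sum of [V] and
    the kernel of [r]. As [V] is nonzero, indecomposability kills the kernel. *)
Lemma split_iso (s : fam V X) : natural s ->
  (forall x v, r x (s x v) = v) -> ~ is_zero V -> indecomposable X ->
  isomorphic X V.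
Proof.
move=> ns rs V0 [_ indX].
have kerP x v : v - s x (r x v) \in kerpred (r x).
  by rewrite unfold_in linearB /= rs subrr.
have pl x : linear (fun v => (r x v, KerOf (kerP x v) : ker_rep x) : rep_sum V ker_rep x).
  move=> a u v; apply: injective_projections => /=; first exact: linearP.
  apply: ker_val_inj; rewrite ker_val_lin /= (linearP (r x)) (linearP (s x)) /= scalerBr opprD.
  by rewrite addrACA.
have ql x : linear (fun u : rep_sum V ker_rep x => s x u.1 + ker_val (u.2 : ker_of (r x))).
  move=> a u v; rewrite scalerDr addrACA -(linearP (s x)); congr (_ + _).
have rk x (u : ker_of (r x)) : r x (ker_val u) = 0.
  by have := ker_valP u; rewrite unfold_in => /eqP.
have [|//|K0] := indX V ker_rep.
  exists (fun x => linear_of (pl x)), (fun x => linear_of (ql x)); split.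
  - move=> x y h v /=; rewrite /sum_map /= nr; congr (_, _).
    by apply: ker_val_inj; rewrite /= linearB /= ns nr.
  - by move=> x y h [v w] /=; rewrite linearD /= ns.
  - by move=> x v /=; rewrite addrCA subrr addr0.
  - move=> x [v w] /=; apply: injective_projections => /=.
      by rewrite linearD /= rs rk addr0.
    by apply: ker_val_inj; rewrite /= linearD /= rs rk addr0 addrAC subrr add0r.
exists r, s; split=> // x v.
have /(congr1 (@ker_val _ _ _ _)) /= e := K0 x (KerOf (kerP x v)).
by apply/eqP; rewrite eq_sym -subr_eq0 e.
Qed.

End KernelRep.

Lemma ereal_between (R : realType) (a : R) (b : \bar R) : (a%:E < b)%E ->
  exists2 c, a < c & (c%:E < b)%E.
Proof.
case: b => [b| |//]; last by exists (a + 1); rewrite ?ltrDl// ltry.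
by rewrite lte_fin => ab; exists ((a + b) / 2); rewrite ?lte_fin ?midf_lt.
Qed.

Lemma ereal_between_right (R : realType) (a : R) (b : \bar R) : (b < a%:E)%E ->
  exists2 c, c < a & (b < c%:E)%E.
Proof.
case: b => [b|//|]; last by exists (a - 1); rewrite ?ltNyr// gtrDl ltrN10.
by rewrite lte_fin => ab; exists ((b + a) / 2); rewrite ?lte_fin ?midf_lt.
Qed.

(** * Splitting or obstruction for families over the whole line *)

Section Lifting.
Context {R : realType} {k : fieldType} {A : cquiver R}.
Variables (l : \bar R) (p q : R) (r : \bar R) (d d' : bool) (m n : int).
Hypotheses (lend : left_end A d l p m) (rend : right_end A d' r q n).
Hypothesis (pq : p < q).

Notation S := (supp l p q r).

(** [e] precedes the first vertex after [p] and [f] follows the last vertex before [q], as the end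
    facts require. *)
Lemma core_points : exists e f : R,
  [/\ p < e, e <= f, f < q, (e%:E < vtx A (m + 1))%E & (vtx A n < f%:E)%E].
Proof.
have [_ _ _ /andP[_ pm] _] := lend; have [_ _ _ /andP[nq _] _] := rend.
have [|e pe] := @ereal_between R p (mine q%:E (vtx A (m + 1))).
  by rewrite lt_min lte_fin pq.
rewrite lt_min lte_fin => /andP[eq em].
have [|f fq] := @ereal_between_right R q (maxe e%:E (vtx A n)).
  by rewrite gt_max lte_fin eq.
by rewrite gt_max lte_fin => /andP[ef nf]; exists e, f; split=> //; apply: ltW.
Qed.

Lemma core_indices : m < n + 1.
Proof.
have [hm _ _ /andP[mp _] _] := lend; have [_ hn _ /andP[_ qn] _] := rend.
apply: (@vtx_inj_lt _ A m (n + 1)) => //.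
by rewrite (le_lt_trans mp)// (lt_le_trans _ qn)// lte_fin.
Qed.

Variable X : rep k A.
Hypothesis Xfd : pointwise_fd X.

Lemma core_zigzag e f : p < e -> e <= f -> f < q -> zigzag X e f.
Proof.
move=> pe ef fq.
have [hm _ _ /andP[mp _] _] := lend; have [_ hn _ /andP[_ qn] _] := rend.
apply: (zigzagP Xfd hm hn core_indices) => //.
  by rewrite (le_trans mp)// lee_fin ltW.
by rewrite (le_trans _ qn)// lee_fin ltW.
Qed.

Lemma endfacts_dual c (O P L : R -> bool) (a b : R) :
  endfacts (ordirect (prec A) c) O P L a b ->
  endfacts (ordirect (fun y x => prec A x y) (~~ c)) O P L a b.
Proof. by case: c. Qed.

Lemma vector_family_split (t : forall x, X x) :
  family_on (rep_diagram X) (fun=> True) (S d d') t ->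
  (exists t1 t2 : forall x, X x,
    [/\ family_on (rep_diagram X) (fun=> True) (S d (~~ d')) t1,
        family_on (rep_diagram X) (fun=> True) (S (~~ d) d') t2
      & forall x, S d d' x -> t x = t1 x + t2 x]) \/
  (exists eta : forall x, dual (X x),
    family_on (dual_diagram X) (fun=> True) (S d d') eta /\
    exists e, eta e (t e) <> 0).
Proof.
move=> ht; have [e [f [pe ef fq em nf]]] := core_points.
have efl := left_endfacts lend pe em; have efr := right_endfacts rend fq nf.
have [[tau [htau al ar]]|[eta [heta hl hr hu]]] :=
  vector_dichotomy Xfd (core_zigzag pe ef fq)
    (admissible_subspace X d p e) (admissible_subspace X d' q f) (t e).
  by left; apply: (family_split (Y := rep_diagram X) (@prec_mid _ A) pe ef fq efl efr ht htau).
right.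
have mid x y c : prec A x y -> (x <= c <= y) || (y <= c <= x) ->
    prec A c y /\ prec A x c.
  by move=> xy; rewrite orbC => /(prec_mid xy)[].
(* In the dual diagram the ends have parameters [~~ d] and [~~ d'], so the extension is supported on
   the complementary choice of blocks, that of N. *)
have [eta' h' he] := family_extends (Y := dual_diagram X) mid pe ef fq
  (endfacts_dual efl) (endfacts_dual efr) heta
  (dual_admissible Xfd hl) (dual_admissible Xfd hr).
exists eta'; rewrite !negbK in h'; split=> //.
by exists e; rewrite he hu; apply/eqP/oner_neq0.
Qed.

Lemma functional_family_split (h : forall x, dual (X x)) :
  family_on (dual_diagram X) (fun=> True) (S (~~ d) (~~ d')) h ->
  (exists h1 h2 : forall x, dual (X x),
    [/\ family_on (dual_diagram X) (fun=> True) (S d (~~ d')) h1,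
        family_on (dual_diagram X) (fun=> True) (S (~~ d) d') h2
      & forall x, S (~~ d) (~~ d') x -> h x = h1 x - h2 x]) \/
  (exists t : forall x, X x,
    family_on (rep_diagram X) (fun=> True) (S (~~ d) (~~ d')) t /\
    exists e, h e (t e) <> 0).
Proof.
move=> hh; have [e [f [pe ef fq em nf]]] := core_points.
have efl := left_endfacts lend pe em; have efr := right_endfacts rend fq nf.
have mid x y c : prec A x y -> (x <= c <= y) || (y <= c <= x) ->
    prec A c y /\ prec A x c.
  by move=> xy; rewrite orbC => /(prec_mid xy)[].
have [[eta [heta hl hr]]|[tau [htau al ar ne0]]] :=
  functional_dichotomy Xfd (core_zigzag pe ef fq)
    (admissible_subspace X d p e) (admissible_subspace X d' q f) (h e).
  left.
  have al : admissible (dual_diagram X) (~~ d) p (h e - eta e).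
    apply: dual_admissible => // v /hl e0.
    by rewrite -[LHS]/(h e v - eta e v) e0 subrr.
  have ar : admissible (dual_diagram X) (~~ d') q (eta f).
    exact: dual_admissible.
  have [t1 [t2 [h1 h2 hE]]] := family_split (Y := dual_diagram X) mid pe ef fq
    (endfacts_dual efl) (endfacts_dual efr) hh heta al ar.
  rewrite !negbK in h1 h2.
  (* Dually the roles of I1 and I2 are exchanged, and the sign is the one of the epimorphism
     [[1 -1]]. *)
  exists t2, (fun x => - t1 x); split=> //.
    have h0 : family_on (dual_diagram X) (fun=> True) (S (~~ d) d') (fun=> 0).
      by split=> // x y _ _ _ _; rewrite act0.
    have := family_onB h0 h1; congr family_on.
    by apply: functional_extensionality_dep => x; apply: sub0r.
  by move=> x Sx; rewrite opprK addrC; apply: hE.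
right.
have [t ht te] := family_extends (Y := rep_diagram X) (@prec_mid _ A) pe ef fq
  efl efr htau al ar.
by exists t; split=> //; exists e; rewrite te.
Qed.

End Lifting.

(** * Morphisms between interval representations *)

Section IntervalHoms.
Context {R : realType} {k : fieldType} {A : cquiver R}.
Implicit Types (J : interval (\bar R)).

Definition entry J x (v : Mint k A J x) : k := @coord k (x%:E \in J) v.

Lemma entryK J x (v : Mint k A J x) : entry v *: (const_mx 1 : Mint k A J x) = v.
Proof. exact: coordK. Qed.

Lemma entry0 J x : entry (0 : Mint k A J x) = 0.
Proof. by rewrite /entry (coord_const 0) mulr0. Qed.

Lemma entry1 J x : x%:E \in J -> entry (const_mx 1 : Mint k A J x) = 1.
Proof. by move=> xJ; rewrite /entry (coord_const 1) xJ mulr1. Qed.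

Lemma entry_trans J x y (v : Mint k A J x) : prec A y x -> y%:E \in J ->
  entry (trans (Mint k A J) x y v) = entry v.
Proof.
move=> h yJ; rewrite (transE h) /entry.
rewrite -[X in coord X]/(ones k (x%:E \in J) (y%:E \in J) v).
by rewrite coord_ones yJ mul1r.
Qed.

Definition scalar J J' (phi : fam (Mint k A J) (Mint k A J')) (x : R) : k :=
  entry (phi x (const_mx 1)).

Lemma scalar_hom J J' (phi : fam (Mint k A J) (Mint k A J')) x v :
  phi x v = (entry v * scalar phi x) *: const_mx 1.
Proof. by rewrite hom_fromE -scalerA entryK. Qed.

Section OneHom.
Variables (J J' : interval (\bar R)) (phi : fam (Mint k A J) (Mint k A J')).
Hypothesis nphi : natural phi.

Lemma scalar_prec x y : prec A y x -> x%:E \in J -> y%:E \in J' ->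
  scalar phi x = scalar phi y.
Proof.
move=> h xJ yJ'; have [_ tc] := hom_from_family nphi.
by rewrite /scalar -(tc x y I I xJ h) /= entry_trans.
Qed.

Lemma scalar_out x : x%:E \notin J \/ x%:E \notin J' -> scalar phi x = 0.
Proof.
case=> xJ; last exact: coord_notin.
have [t0 _] := hom_from_family nphi.
by rewrite /scalar t0// entry0.
Qed.

Variables (i j : int).
Hypotheses (hi : hasidx A i) (hj : hasidx A j) (ij : i < j).
Hypothesis JJ'ij : forall x : R, x%:E \in J -> x%:E \in J' ->
  (vtx A i <= x%:E)%E && (x%:E <= vtx A j)%E.

(** The scalar is preserved along arrows inside the intersection of [J] and [J'], which is convex,
    so any two of its points are joined through segments. *)
Lemma scalar_const x y : x%:E \in J -> x%:E \in J' -> y%:E \in J ->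
  y%:E \in J' -> scalar phi x = scalar phi y.
Proof.
move=> xJ xJ' yJ yJ'.
suff hle u v : u <= v -> u%:E \in J -> u%:E \in J' -> v%:E \in J ->
    v%:E \in J' -> scalar phi u = scalar phi v.
  by case: (leP x y) => [|/ltW] xy; [|symmetry]; apply: hle.
move=> uv uJ uJ' vJ vJ'.
have /andP[iu _] := JJ'ij uJ uJ'; have /andP[_ jv] := JJ'ij vJ vJ'.
(* Memberships become part of the relation proved by [chain_ind]; those of a cutting vertex follow
   by convexity. *)
suff : u%:E \in J -> u%:E \in J' -> v%:E \in J -> v%:E \in J' ->
  scalar phi u = scalar phi v by apply.
move: u v iu uv jv {uJ uJ' vJ vJ'}; apply: (chain_ind hi hj ij).
- move=> h u v hh hh1 su sv uv uJ uJ' vJ vJ'.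
  case: (boolP (evenz h)) => ev; [symmetry|]; apply: scalar_prec => //.
    by rewrite (precE hh hh1)// ev.
  by rewrite (precE hh hh1)// (negbTE ev).
- move=> u v w uv vw huv hvw uJ uJ' wJ wJ'.
  have hb : (u <= v <= w) || (w <= v <= u) by rewrite uv vw.
  have vJ : v%:E \in J by apply: itv_conv uJ wJ; rewrite orbC.
  have vJ' : v%:E \in J' by apply: itv_conv uJ' wJ'; rewrite orbC.
  by rewrite huv// hvw.
Qed.

Lemma hom_zero x : x%:E \in J -> x%:E \in J' -> scalar phi x = 0 ->
  forall y v, phi y v = 0.
Proof.
move=> xJ xJ' x0 y v; rewrite scalar_hom.
have [yJ|yJ] := orP (orbN (y%:E \in J)); last first.
  by rewrite (scalar_out (or_introl yJ)) mulr0 scale0r.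
have [yJ'|yJ'] := orP (orbN (y%:E \in J')); last first.
  by rewrite (scalar_out (or_intror yJ')) mulr0 scale0r.
by rewrite (scalar_const yJ yJ' xJ xJ') x0 mulr0 scale0r.
Qed.

End OneHom.

Lemma end_scalar J (phi : fam (Mint k A J) (Mint k A J)) i j x :
  natural phi -> hasidx A i -> hasidx A j -> i < j ->
  (forall x : R, x%:E \in J -> (vtx A i <= x%:E)%E && (x%:E <= vtx A j)%E) ->
  x%:E \in J -> forall y v, phi y v = scalar phi x *: v.
Proof.
move=> nphi hi hj ij Jij xJ y v.
have [yJ|yJ] := orP (orbN (y%:E \in J)); last exact: Mint_out.
rewrite scalar_hom mulrC -scalerA entryK.
congr (_ *: _); apply: (scalar_const nphi hi hj ij) => //.
by move=> z zJ _; apply: Jij.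
Qed.

Definition fam_inl (V W : rep k A) : fam V (rep_sum V W).
Proof.
move=> x; apply: (@linear_of k (V x) (rep_sum V W x) (fun v => (v, 0))).
by move=> a u v; apply: injective_projections; rewrite /= ?scaler0 ?addr0.
Defined.

Definition fam_inr (V W : rep k A) : fam W (rep_sum V W).
Proof.
move=> x; apply: (@linear_of k (W x) (rep_sum V W x) (fun v => (0, v))).
by move=> a u v; apply: injective_projections; rewrite /= ?scaler0 ?addr0.
Defined.

Definition fam_fst (V W : rep k A) : fam (rep_sum V W) V.
Proof.
by move=> x; apply: (@linear_of k (rep_sum V W x) (V x) (fun u => u.1)).
Defined.

Definition fam_snd (V W : rep k A) : fam (rep_sum V W) W.
Proof.
by move=> x; apply: (@linear_of k (rep_sum V W x) (W x) (fun u => u.2)).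
Defined.

Lemma fam_inl_natural (V W : rep k A) : natural (fam_inl V W).
Proof. by move=> x y h v; rewrite /= /sum_map /= linear0. Qed.

Lemma fam_inr_natural (V W : rep k A) : natural (fam_inr V W).
Proof. by move=> x y h v; rewrite /= /sum_map /= linear0. Qed.

Lemma fam_fst_natural (V W : rep k A) : natural (fam_fst V W).
Proof. by []. Qed.

Lemma fam_snd_natural (V W : rep k A) : natural (fam_snd V W).
Proof. by []. Qed.

Definition fam_scale (V W : rep k A) (a : k) (f : fam V W) : fam V W.
Proof.
move=> x; apply: (@linear_of k (V x) (W x) (fun v => a *: f x v)).
by move=> b u v; rewrite linearP scalerDr !scalerA mulrC.
Defined.

Lemma fam_scale_natural (V W : rep k A) a (f : fam V W) :
  natural f -> natural (fam_scale a f).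
Proof. by move=> nf x y h v; rewrite /= linearZ nf. Qed.

Lemma split_iso_scalar (X V : rep k A) (s : fam V X) (r : fam X V) (c : k) :
  natural s -> natural r -> c != 0 -> (forall x v, r x (s x v) = c *: v) ->
  ~ is_zero V -> indecomposable X -> isomorphic X V.
Proof.
move=> ns nr c0 rs; apply: (split_iso (fam_scale_natural c^-1 nr) ns) => x v /=.
by rewrite rs scalerK.
Qed.

Lemma Mint_nonzero J x : x%:E \in J -> ~ is_zero (Mint k A J).
Proof.
move=> xJ /(_ x (const_mx 1)) /(congr1 (@entry J x)).
by rewrite entry1// entry0 => /eqP; rewrite oner_eq0.
Qed.

(** The projection onto [V1] becomes an endomorphism of [Mint J], hence a scalar: if it is 0 then
    [V1] vanishes, otherwise [V2] does. *)
Lemma Mint_indecomposable J i j x :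
  hasidx A i -> hasidx A j -> i < j ->
  (forall x : R, x%:E \in J -> (vtx A i <= x%:E)%E && (x%:E <= vtx A j)%E) ->
  x%:E \in J -> indecomposable (Mint k A J).
Proof.
move=> hi hj ij Jij xJ; split; first exact: Mint_nonzero xJ.
move=> V1 V2 [f [g [nf ng gf fg]]].
pose phi : fam (Mint k A J) (Mint k A J) :=
  fam_comp (fam_comp f (fam_comp (fam_fst V1 V2) (fam_inl V1 V2))) g.
have nphi : natural phi.
  apply: fam_comp_natural => //; apply: fam_comp_natural => //.
  by apply: fam_comp_natural; [exact: fam_fst_natural | exact: fam_inl_natural].
have phiE := end_scalar nphi hi hj ij Jij xJ.
have [c0|c0] := eqVneq (scalar phi x) 0; [left|right] => y v.
- have := phiE y (g y (v, 0)); rewrite c0 scale0r /phi /= fg /= => e.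
  by have := fg y (v, 0); rewrite e linear0 => -[].
- have := phiE y (g y (0, v)); rewrite /phi /= fg /= linear0.
  move=> /esym/eqP; rewrite scaler_eq0 (negbTE c0) /= => /eqP e.
  by have := fg y (0, v); rewrite e linear0 => -[].
Qed.

End IntervalHoms.

(** * Non-splitness and the two factorization properties *)

Section AlmostSplit.
Context {R : realType} {k : fieldType} {A : cquiver R}.
Variables (N I1 I2 M : interval (\bar R)).
Variables (l : \bar R) (p q : R) (r : \bar R) (d d' : bool) (m n : int).
Hypotheses (lend : left_end A d l p m) (rend : right_end A d' r q n).
Hypothesis (pq : p < q).

Notation S := (supp l p q r).
Hypothesis memN : forall x : R, (x%:E \in N) = S d d' x.
Hypothesis mem1 : forall x : R, (x%:E \in I1) = S d (~~ d') x.
Hypothesis mem2 : forall x : R, (x%:E \in I2) = S (~~ d) d' x.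
Hypothesis memM : forall x : R, (x%:E \in M) = S (~~ d) (~~ d') x.

Lemma supp_range : exists i j : int,
  [/\ hasidx A i, hasidx A j, i < j
    & forall a b x, S a b x -> (vtx A i <= x%:E)%E && (x%:E <= vtx A j)%E].
Proof.
have [i [hi im il ip]] : exists i, [/\ hasidx A i, i <= m, (vtx A i <= l)%E
    & (vtx A i <= p%:E)%E].
  have [hm _ _ /andP[mp _] [[-> _]|[mE hm' ->]]] := lend; first by exists m.
  by exists (m - 1); split; rewrite ?lerBlDr ?lerDl// -mE vtx_leq// lerBlDr lerDl.
have [j [hj nj jr qj]] : exists j, [/\ hasidx A j, n + 1 <= j, (r <= vtx A j)%E
    & (q%:E <= vtx A j)%E].
  have [_ hn _ /andP[_ qn] [[-> _]|[nE hn' ->]]] := rend; first by exists (n + 1).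
  by exists (n + 1 + 1); split; rewrite ?lerDl// -nE vtx_leq// lerDl.
exists i, j; split=> //.
  by rewrite (le_lt_trans im)// (lt_le_trans (core_indices lend rend pq)).
move=> a b x; rewrite /supp => /or3P[/andP[px xq]|/and3P[_ lx xp]|/and3P[_ qx xr]].
- apply/andP; split; first by rewrite (le_trans ip)// lee_fin ltW.
  by rewrite (le_trans _ qj)// lee_fin ltW.
- rewrite (le_trans il)//= (le_trans _ qj)// lee_fin.
  by rewrite (le_trans xp)// ltW.
- by rewrite (le_trans _ jr)// andbT (le_trans ip)// lee_fin (le_trans (ltW pq)).
Qed.

Lemma hom_range (J J' : interval (\bar R)) a b a' b' :
  (forall x : R, (x%:E \in J) = S a b x) ->
  (forall x : R, (x%:E \in J') = S a' b' x) ->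
  exists i j : int, [/\ hasidx A i, hasidx A j, i < j
    & forall x : R, x%:E \in J -> x%:E \in J' ->
        (vtx A i <= x%:E)%E && (x%:E <= vtx A j)%E].
Proof.
move=> mJ mJ'; have [i [j [hi hj ij hS]]] := supp_range.
by exists i, j; split=> // x; rewrite mJ => /hS.
Qed.

Lemma supp_p a b : S a b p = a.
Proof.
by rewrite /supp ltxx lexx (left_end_le lend) (leNgt q) pq /= !andbF andbT orbF.
Qed.

Lemma supp_q a b : S a b q = b.
Proof.
by rewrite /supp ltxx lexx (right_end_le rend) (leNgt q) pq /= !andbF andbT.
Qed.

(** Exactly one of [J] and [J'] contains [p], so the scalar at [p] is 0. The arrow between [p] and
    [e] starts in [J] and ends in [J'] for either value of [d], so naturality carries this 0 to [e],
    hence everywhere. *)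
Lemma hom_zero_left (J J' : interval (\bar R)) b b' (phi : fam (Mint k A J) (Mint k A J')) :
  (forall x : R, (x%:E \in J) = S (~~ d) b x) ->
  (forall x : R, (x%:E \in J') = S d b' x) ->
  natural phi -> forall x v, phi x v = 0.
Proof.
move=> mJ mJ' nphi; have [i [j [hi hj ij hS]]] := hom_range mJ mJ'.
have [e [f [pe ef fq em nf]]] := core_points lend rend pq.
have eC a c : S a c e by rewrite supp_mid// (le_lt_trans ef).
apply: (@hom_zero _ _ _ _ _ _ nphi i j hi hj ij hS e); rewrite ?mJ ?mJ'//.
have [_ _ /(_ e) he _ _ _ _] := left_endfacts lend pe em.
have {he} [|_] := he; first by rewrite pe lexx.
have out : scalar phi p = 0.
  by apply: scalar_out => //; rewrite mJ mJ' !supp_p; case: (d); [left|right].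
case: (d) mJ mJ' => mJ mJ' pe'; rewrite -out.
  by apply: scalar_prec => //; rewrite ?mJ ?mJ' ?supp_p.
by symmetry; apply: scalar_prec => //; rewrite ?mJ ?mJ' ?supp_p.
Qed.

Lemma hom_zero_right (J J' : interval (\bar R)) b b' (phi : fam (Mint k A J) (Mint k A J')) :
  (forall x : R, (x%:E \in J) = S b (~~ d') x) ->
  (forall x : R, (x%:E \in J') = S b' d' x) ->
  natural phi -> forall x v, phi x v = 0.
Proof.
move=> mJ mJ' nphi; have [i [j [hi hj ij hS]]] := hom_range mJ mJ'.
have [e [f [pe ef fq em nf]]] := core_points lend rend pq.
have fC a c : S a c f by rewrite supp_mid// (lt_le_trans pe).
apply: (@hom_zero _ _ _ _ _ _ nphi i j hi hj ij hS f); rewrite ?mJ ?mJ'//.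
have [_ _ /(_ f) hf _ _ _ _] := right_endfacts rend fq nf.
have {hf} [|_] := hf; first by rewrite lexx.
have out : scalar phi q = 0.
  by apply: scalar_out => //; rewrite mJ mJ' !supp_q; case: (d'); [left|right].
case: (d') mJ mJ' => mJ mJ' qf; rewrite -out.
  by apply: scalar_prec => //; rewrite ?mJ ?mJ' ?supp_q.
by symmetry; apply: scalar_prec => //; rewrite ?mJ ?mJ' ?supp_q.
Qed.

Lemma core_point : exists e, forall a b, S a b e.
Proof.
have [e [f [pe ef fq _ _]]] := core_points lend rend pq.
by exists e => a b; rewrite supp_mid// (le_lt_trans ef).
Qed.

Lemma supp_indecomposable (J : interval (\bar R)) a b :
  (forall x : R, (x%:E \in J) = S a b x) -> indecomposable (Mint k A J).
Proof.
move=> mJ; have [i [j [hi hj ij hS]]] := hom_range mJ mJ.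
have [e eC] := core_point.
by apply: (@Mint_indecomposable _ _ _ J i j e) => // [x xJ|]; [exact: hS | rewrite mJ].
Qed.

(** A retraction would have components I1 -> N and I2 -> N, which vanish because of the right and of
    the left block respectively. *)
Lemma mono11_not_section : ~ is_section (@mono11 R k A N I1 I2).
Proof.
move=> [s ns sf]; have [e eC] := core_point.
have eN : e%:E \in N by rewrite memN.
apply: (@Mint_nonzero R k A N e eN) => x v; rewrite -(sf x v).
have -> : @mono11 R k A N I1 I2 x v = fam_inl _ _ x (@mono11 R k A N I1 I2 x v).1 +
    fam_inr _ _ x (@mono11 R k A N I1 I2 x v).2.
  by apply: injective_projections; rewrite /= ?addr0 ?add0r.
rewrite linearD.
have z1 := hom_zero_right mem1 memN (phi := fam_comp (fam_inl _ (Mint k A I2)) s)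
   (fam_comp_natural (@fam_inl_natural _ _ _ _ _) ns).
have z2 := hom_zero_left mem2 memN (phi := fam_comp (fam_inr (Mint k A I1) _) s)
   (fam_comp_natural (@fam_inr_natural _ _ _ _ _) ns).
rewrite -[RHS]addr0; congr (_ + _); [exact: (z1 x) | exact: (z2 x)].
Qed.

Lemma epi1N1_not_retraction : ~ is_retraction (@epi1N1 R k A I1 I2 M).
Proof.
move=> [s ns sf]; have [e eC] := core_point.
have eM : e%:E \in M by rewrite memM.
apply: (@Mint_nonzero R k A M e eM) => x v; rewrite -(sf x v).
have z1 := hom_zero_left memM mem1 (phi := fam_comp s (fam_fst _ _))
  (fam_comp_natural ns (@fam_fst_natural _ _ _ _ _)).
have z2 := hom_zero_right memM mem2 (phi := fam_comp s (fam_snd _ _))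
  (fam_comp_natural ns (@fam_snd_natural _ _ _ _ _)).
have -> : s x v = 0.
  by apply: injective_projections; [exact: (z1 x v) | exact: (z2 x v)].
exact: linear0.
Qed.

Lemma left_almost_split (X : rep k A) (h : fam (Mint k A N) X) :
  in_repk X -> indecomposable X -> ~ isomorphic X (Mint k A N) -> natural h ->
  exists2 h' : fam (rep_sum (Mint k A I1) (Mint k A I2)) X, natural h' &
    forall x v, h x v = h' x (@mono11 R k A N I1 I2 x v).
Proof.
move=> [Xfd _] Xind niso nh.
have ht := family_on_eq (fun x _ => memN x) (hom_from_family nh).
have [[t1 [t2 [h1 h2 hE]]]|[eta [heta [e ne0]]]] :=
    vector_family_split lend rend pq Xfd ht.
  have f1 : family_on (rep_diagram X) (fun=> True) (fun x => x%:E \in I1) t1.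
    by apply: family_on_eq h1 => x _; rewrite mem1.
  have f2 : family_on (rep_diagram X) (fun=> True) (fun x => x%:E \in I2) t2.
    by apply: family_on_eq h2 => x _; rewrite mem2.
  exists (fam_copair (hom_from I1 t1) (hom_from I2 t2)).
    by apply: fam_copair_natural; apply: hom_from_natural.
  move=> x v; rewrite hom_fromE /=.
  rewrite -[X in @coord _ _ X *: t1 x]/(ones k (x%:E \in N) (x%:E \in I1) v).
  rewrite -[X in @coord _ _ X *: t2 x]/(ones k (x%:E \in N) (x%:E \in I2) v).
  rewrite !coord_ones -!scalerA.
  have [xN|xN] := orP (orbN (x%:E \in N)); last first.
    by rewrite (coord_notin _ xN) !scale0r !scaler0 addr0.
  have outE (J : interval (\bar R)) (t : forall x, X x) :
      family_on (rep_diagram X) (fun=> True) (fun x => x%:E \in J) t ->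
      (x%:E \in J)%:R *: (@coord k (x%:E \in N) v *: t x) = @coord k (x%:E \in N) v *: t x.
    move=> [t0 _]; have [xJ|xJ] := orP (orbN (x%:E \in J)).
      by rewrite xJ scale1r.
    by rewrite t0// !scaler0.
  by rewrite !outE// -scalerDr -hE// -memN.
case: niso.
have heta' : family_on (dual_diagram X) (fun=> True) (fun x => x%:E \in N) eta.
  by apply: family_on_eq heta => x _; rewrite memN.
pose s := hom_to N eta; have nsN : natural s := hom_to_natural heta'.
pose phi := fam_comp h s; have nphi : natural phi := fam_comp_natural nh nsN.
have eN : e%:E \in N.
  apply: contra_notT ne0 => eN.
  by case: heta' => t0 _; rewrite t0.
have [i [j [hi hj ij hS]]] := hom_range memN memN.
have phiE := end_scalar nphi hi hj ij (fun x xN => hS x xN xN) eN.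
have ce : scalar phi e = eta e (h e (const_mx 1)).
  exact: coordZ1_in.
apply: (split_iso_scalar nh nsN _ phiE) => //; last exact: Mint_nonzero eN.
by rewrite ce; apply/eqP.
Qed.

Lemma right_almost_split (X : rep k A) (h : fam X (Mint k A M)) :
  in_repk X -> indecomposable X -> ~ isomorphic X (Mint k A M) -> natural h ->
  exists2 h' : fam X (rep_sum (Mint k A I1) (Mint k A I2)), natural h' &
    forall x v, h x v = @epi1N1 R k A I1 I2 M x (h' x v).
Proof.
move=> [Xfd _] Xind niso nh.
have hh := family_on_eq (fun x _ => memM x) (hom_to_family nh).
have [[h1 [h2 [f1 f2 hE]]]|[t [ht [e ne0]]]] :=
    functional_family_split lend rend pq Xfd hh.
  have {}f1 : family_on (dual_diagram X) (fun=> True) (fun x => x%:E \in I1) h1.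
    by apply: family_on_eq f1 => x _; rewrite mem1.
  have {}f2 : family_on (dual_diagram X) (fun=> True) (fun x => x%:E \in I2) h2.
    by apply: family_on_eq f2 => x _; rewrite mem2.
  exists (fam_pair (hom_to I1 h1) (hom_to I2 h2)).
    by apply: fam_pair_natural; apply: hom_to_natural.
  move=> x v; have [xM|xM] := orP (orbN (x%:E \in M)); last exact: Mint_out.
  have xM' : S (~~ d) (~~ d') x by rewrite -memM.
  have outE (J : interval (\bar R)) (eta : forall x, dual (X x)) :
      family_on (dual_diagram X) (fun=> True) (fun x => x%:E \in J) eta ->
      ones k (x%:E \in J) (x%:E \in M) (hom_to J eta x v) = eta x v *: const_mx 1.
    move=> [t0 _]; rewrite onesE /= coordZ1.
    have [xJ|xJ] := orP (orbN (x%:E \in J)); first by rewrite xJ mul1r.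
    by rewrite t0// dual_zeroE mulr0.
  have e : h1 x v - h2 x v = @coord k (x%:E \in M) (h x v).
    by rewrite -dual_subE -hE.
  transitivity (h1 x v *: const_mx 1 - h2 x v *: const_mx 1 : Mint k A M x).
    by rewrite -scalerBl e; symmetry; apply: coordK.
  by symmetry; congr (_ - _); apply: outE.
case: niso.
have ht' : family_on (rep_diagram X) (fun=> True) (fun x => x%:E \in M) t.
  by apply: family_on_eq ht => x _; rewrite memM.
pose s := hom_from M t; have nsM : natural s := hom_from_natural ht'.
pose phi := fam_comp s h; have nphi : natural phi := fam_comp_natural nsM nh.
have eM : e%:E \in M.
  apply: contra_notT ne0 => eM.
  by case: ht' => t0 _; rewrite t0// dual0.
have [i [j [hi hj ij hS]]] := hom_range memM memM.
have phiE := end_scalar nphi hi hj ij (fun x xM => hS x xM xM) eM.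
have ce : scalar phi e = hom_to_coord h e (t e).
  have se : s e (const_mx 1) = t e.
    by rewrite -[RHS]scale1r; congr (_ *: _); apply: (@entry1 R k A M e eM).
  by rewrite /scalar -[phi e _]/(h e (s e _)) se.
apply: (split_iso_scalar nsM nh _ phiE) => //; last exact: Mint_nonzero eM.
by rewrite ce; apply/eqP.
Qed.

End AlmostSplit.

(** * Down-closures and indecomposable projectives *)

Section DownClosures.
Context {R : realType} (A : cquiver R).
Implicit Types (x y z a : R) (m n i j : int) (J K : interval (\bar R)).

(** [+oo] is itself an indexed element, of index beyond [n]; convexity of the index set then
    supplies [n + 1]. That index may be infinite. *)
Lemma next_idx n (a : \bar R) : hasidx A n -> (vtx A n < a)%E ->
  hasidx A (n + 1).
Proof.
move=> hn na.
have [t ht tE] : (cq_elt A @` cq_idx A)%classic +oo%E.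
  by rewrite cq_elt_image; right; right.
have nt : (n%:E < t)%E.
  rewrite ltNge le_eqVlt; apply/negP => /orP[/eqP e|tn].
    by move: na; rewrite /vtx -e tE; apply/negP; rewrite -leNgt leey.
  by have := cq_elt_incr ht hn tn; rewrite tE; apply/negP; rewrite -leNgt leey.
apply: (cq_idx_convex hn ht); first by rewrite lee_fin lerDl.
by case: t nt {ht tE} => [t| |//]; rewrite ?leey// lee_fin lte_fin lezD1.
Qed.

Lemma prev_idx n (a : \bar R) : hasidx A n -> (a < vtx A n)%E ->
  hasidx A (n - 1).
Proof.
move=> hn an.
have [t ht tE] : (cq_elt A @` cq_idx A)%classic -oo%E.
  by rewrite cq_elt_image; right; left.
have tn : (t < n%:E)%E.
  rewrite ltNge le_eqVlt; apply/negP => /orP[/eqP e|nt].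
    by move: an; rewrite /vtx e tE; apply/negP; rewrite -leNgt leNye.
  by have := cq_elt_incr hn ht nt; rewrite tE; apply/negP; rewrite -leNgt leNye.
apply: (cq_idx_convex ht hn); last by rewrite lee_fin lerBlDr lerDl.
by case: t tn {ht tE} => [t|//|]; rewrite ?leNye// lee_fin lte_fin lerBrDr lezD1.
Qed.

Lemma seg_vertex n m x : hasidx A n -> hasidx A (n + 1) -> hasidx A m ->
  hasidx A (m + 1) -> seg A n x -> seg A m x -> n < m ->
  m = n + 1 /\ x%:E = vtx A m.
Proof.
move=> hn hn1 hm hm1 /andP[nx xn] /andP[mx xm] nm.
have mn : m <= n + 1 by apply: (vtx_inj_le hm hn1); apply: le_trans xn.
have mE : m = n + 1 by clear -mn nm; lia.
by split=> //; apply/le_anti; rewrite mx andbT mE xn.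
Qed.

(** If the two relations live in different segments, [y] is their common vertex. Being a sink or a
    source, it makes one of the relations an equality. *)
Lemma prec_trans x y z : prec A z y -> prec A y x -> prec A z x.
Proof.
move=> zy yx; have [n [hn hn1 ny nz]] := prec_seg zy.
have [m [hm hm1 mx my]] := prec_seg yx.
have [nm|mn|nm] := ltgtP n m; last first.
- subst m; move: zy yx; rewrite !(precE hn hn1)//.
  by case: ifP => _ h1 h2; [exact: le_trans h2 | exact: le_trans h1].
- have [nE yE] := seg_vertex hm hm1 hn hn1 my ny mn.
  move: (zy) (yx); rewrite (precE hn hn1)// (precE hm hm1)// nE evenzD1.
  case: (evenz m) => /= h1 h2.
    suff -> : x = y by [].
    apply/le_anti; rewrite h2 andbT -lee_fin yE nE; exact: (proj2 (andP mx)).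
  suff -> : z = y by [].
  apply/le_anti; rewrite h1 /= -lee_fin yE; exact: (proj1 (andP nz)).
- have [mE yE] := seg_vertex hn hn1 hm hm1 ny my nm.
  move: (zy) (yx); rewrite (precE hn hn1)// (precE hm hm1)// mE evenzD1.
  case: (evenz n) => /= h1 h2.
    suff -> : x = y by [].
    apply/le_anti; rewrite h2 /= -lee_fin yE; exact: (proj1 (andP mx)).
  suff -> : z = y by [].
  apply/le_anti; rewrite h1 andbT -lee_fin yE mE; exact: (proj2 (andP nz)).
Qed.

Lemma prec_refl n x : hasidx A n -> hasidx A (n + 1) -> seg A n x ->
  prec A x x.
Proof. by move=> hn hn1 sx; rewrite (precE hn hn1)//; case: ifP. Qed.

Lemma prec_interior n x y : hasidx A n -> hasidx A (n + 1) ->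
  (vtx A n < y%:E)%E -> (y%:E < vtx A (n + 1))%E ->
  prec A x y <-> seg A n x /\ if evenz n then x <= y else y <= x.
Proof.
move=> hn hn1 ny yn; have sy : seg A n y by rewrite /seg !ltW.
split=> [xy|[sx h]]; last by rewrite (precE hn hn1).
have [m [hm hm1 my mx]] := prec_seg xy.
have mn := seg_interior hn hn1 hm hm1 ny yn my; subst m.
by split=> //; rewrite -(precE hn hn1).
Qed.

(** The inequality excludes the sink of segment [n]. An interior [a] gives the part of the segment
    between the sink and [a]; if [a] is the source vertex, both adjacent segments belong to its
    down-set. *)
Lemma down_interval n a : hasidx A n -> hasidx A (n + 1) ->
  seg A n a ->
  (if evenz n then (vtx A n < a%:E)%E else (a%:E < vtx A (n + 1))%E) ->
  exists K, forall x, x%:E \in K <-> prec A x a.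
Proof.
move=> hn hn1 /[dup] sa /andP[na an]; case: (boolP (evenz n)) => ev h.
- have [an'|] := ltP a%:E (vtx A (n + 1)).
    exists `[vtx A n, a%:E] => x; rewrite (prec_interior _ hn hn1)// ev.
    rewrite itv_boundlr /= !bnd_simp /seg lee_fin; split=> [/andP[nx xa]|[]].
      by split=> //; rewrite nx (le_trans _ an)// lee_fin.
    by move=> /andP[-> _] ->.
  move=> an'; have aE : a%:E = vtx A (n + 1) by apply/le_anti; rewrite an an'.
  have hn2 : hasidx A (n + 1 + 1) by apply: (@next_idx _ +oo%E) => //; rewrite -aE ltry.
  have sa' : seg A (n + 1) a by rewrite /seg aE lexx vtx_leq// lerDl.
  exists `[vtx A n, vtx A (n + 1 + 1)] => x.
  rewrite itv_boundlr /= !bnd_simp; split=> [/andP[nx xn]|xa].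
    have [xa|ax] := leP x a.
      by rewrite (precE hn hn1) ?ev// /seg nx -aE lee_fin.
    rewrite (precE hn1 hn2) ?evenzD1 ?ev /= ?(ltW ax)//.
    by rewrite /seg xn -aE lee_fin ltW.
  have [m [hm hm1 ma mx]] := prec_seg xa.
  have [mn|nm|mn] := ltgtP m n.
  + have [_ e] := seg_vertex hm hm1 hn hn1 ma sa mn.
    by move: h; rewrite e ltxx.
  + have [mE _] := seg_vertex hn hn1 hm hm1 sa ma nm.
    subst m; case/andP: mx => h1 h2; rewrite h2 (le_trans _ h1)//.
    by rewrite vtx_leq// lerDl.
  + subst m; case/andP: mx => h1 h2; rewrite h1 (le_trans h2)//.
    by rewrite vtx_leq// lerDl.
- have [na'|] := ltP (vtx A n) a%:E.
    exists `[a%:E, vtx A (n + 1)] => x.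
    rewrite (prec_interior _ hn hn1)// (negbTE ev).
    rewrite itv_boundlr /= !bnd_simp /seg lee_fin; split=> [/andP[ax xn]|[]].
      by split=> //; rewrite xn (le_trans na)// lee_fin.
    by move=> /andP[_ ->] ->.
  move=> na'; have aE : a%:E = vtx A n by apply/le_anti; rewrite na na'.
  have hn0 : hasidx A (n - 1) by apply: (@prev_idx _ -oo%E) => //; rewrite -aE ltNyr.
  have n0 : n - 1 + 1 = n by rewrite subrK.
  have hn0' : hasidx A (n - 1 + 1) by rewrite n0.
  have le0 : (vtx A (n - 1) <= vtx A n)%E by rewrite vtx_leq// lerBlDr lerDl.
  have sa' : seg A (n - 1) a by rewrite /seg n0 aE lexx andbT.
  have ev0 : evenz (n - 1) by rewrite -[evenz _]negbK -evenzD1 n0.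
  exists `[vtx A (n - 1), vtx A (n + 1)] => x.
  rewrite itv_boundlr /= !bnd_simp; split=> [/andP[nx xn]|xa].
    have [ax|xa] := leP a x.
      by rewrite (precE hn hn1) ?(negbTE ev)// /seg xn andbT -aE lee_fin.
    rewrite (precE hn0 hn0') ?ev0 ?(ltW xa)//.
    by rewrite /seg n0 nx -aE lee_fin ltW.
  have [m [hm hm1 ma mx]] := prec_seg xa.
  have [mn|nm|mn] := ltgtP m n.
  + have [nE _] := seg_vertex hm hm1 hn hn1 ma sa mn.
    case/andP: mx => h1 h2; have -> : n - 1 = m by rewrite nE addrK.
    by rewrite h1 (le_trans h2)// -nE vtx_leq// lerDl.
  + have [mE e] := seg_vertex hn hn1 hm hm1 sa ma nm.
    by move: h; rewrite e mE ltxx.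
  + subst m; case/andP: mx => h1 h2; rewrite h2 (le_trans le0)//.
Qed.

(** If the part of [J] in segment [n] has a point nearest to the source, the closure is the down-set
    of that point. Otherwise it runs from the sink to a bound [b] that is not attained: a one-sided
    projective at [b] if [b] is finite, and the projective at infinity if not. *)
Lemma down_closure_projective J n y0 : hasidx A n -> hasidx A (n + 1) ->
  y0%:E \in J -> (vtx A n < y0%:E)%E -> (y0%:E < vtx A (n + 1))%E ->
  exists2 K, proj_support A K &
    forall x, x%:E \in K <-> exists y, [/\ y%:E \in J, seg A n y & prec A x y].
Proof.
move=> hn hn1 Jy0 ny0 y0n.
have sy0 : seg A n y0 by rewrite /seg !ltW.
pose E := [set y | y%:E \in J /\ seg A n y]%classic.
have [ev|ev] := boolP (evenz n).
- have precn x y : seg A n x -> seg A n y -> prec A x y <-> x <= y.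
    by move=> sx sy; rewrite (precE hn hn1)// ev.
  have [[a [Ja sa] amax]|nomax] := pselect (exists2 a, E a & forall y, E y -> y <= a).
    have y0a : y0 <= a by exact: amax.
    have [|K hK] := down_interval hn hn1 sa.
      by rewrite ev (lt_le_trans ny0)// lee_fin.
    have KE x : x%:E \in K <-> exists y, [/\ y%:E \in J, seg A n y & prec A x y].
      rewrite hK; split=> [xa|[y [Jy sy xy]]]; first by exists a.
      by apply: prec_trans xy _; rewrite precn//; apply: amax.
    exists K => //; apply: (@proj_at _ _ _ a).
    by apply/seteqP; split=> x; rewrite /trace /= hK.
  have up y : E y -> exists2 y', E y' & y < y'.
    move=> Ey; apply: contrapT => h; apply: nomax; exists y => // z Ez.
    by rewrite leNgt; apply/negP => yz; apply: h; exists z.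
  pose b := ereal_sup (EFin @` E)%classic.
  have bn : (b <= vtx A (n + 1))%E.
    by apply: ge_ereal_sup => _ [y [_ /andP[_ ?]] <-].
  have Eb y : E y -> (y%:E < b)%E.
    move=> /up[y' Ey' yy']; apply: (@lt_le_trans _ _ y'%:E); first by rewrite lte_fin.
    by apply: ereal_sup_ubound; exists y'.
  have KE x : (x%:E \in `[vtx A n, b[) <->
      exists y, [/\ y%:E \in J, seg A n y & prec A x y].
    rewrite itv_boundlr /= !bnd_simp; split=> [/andP[nx xb]|[y [Jy sy xy]]].
      have [_ [y [Jy sy] <-]] := ereal_sup_gt xb.
      rewrite lte_fin => xy'; exists y; split=> //.
      rewrite precn ?(ltW xy')// /seg nx.
      by case/andP: sy => _; apply: le_trans; rewrite lee_fin ltW.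
    (* Moving up twice makes [y'] interior to the segment, so that its down-set stays inside. *)
    have [y' [Jy' sy'] yy'] := up y (conj Jy sy).
    have [y2 [_ /andP[_ y2n]] y'y2] := up y' (conj Jy' sy').
    have ny' : (vtx A n < y'%:E)%E.
      by case/andP: sy => ny _; rewrite (le_lt_trans ny)// lte_fin.
    have y'n : (y'%:E < vtx A (n + 1))%E by rewrite (lt_le_trans _ y2n)// lte_fin.
    have : prec A x y'.
      by apply: prec_trans xy _; rewrite precn// ltW.
    rewrite (prec_interior _ hn hn1)// ev => -[/andP[-> _] xy' /=].
    by rewrite (le_lt_trans _ (Eb y' (conj Jy' sy')))// lee_fin.
  exists `[vtx A n, b[ => //.
  have y0b : (y0%:E < b)%E by apply: Eb.
  case bE : b y0b => [c| |//] y0b.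
    have sc : seg A n c by rewrite /seg -bE bn bE (le_trans (ltW ny0))// ltW.
    apply: (@proj_left _ _ _ c); first by exists y0; rewrite /trace /= -bE KE; exists y0;
      split=> //; apply: (prec_refl hn hn1).
    apply/seteqP; split=> x; rewrite /trace /= itv_boundlr /= !bnd_simp.
      move=> /andP[nx]; rewrite lte_fin => xc; split=> //.
      rewrite precn ?(ltW xc)// /seg nx; case/andP: sc => _.
      by apply: le_trans; rewrite lee_fin ltW.
    move=> [xc' xc]; rewrite lte_fin xc andbT.
    have [m [hm hm1 mc mx]] := prec_seg xc'.
    have [mn|nm|<-] := ltgtP m n; last by case/andP: mx.
      have [_ e] := seg_vertex hm hm1 hn hn1 mc sc mn.
      by move: y0b; rewrite e ltNge (ltW ny0).
    have [mE e] := seg_vertex hn hn1 hm hm1 sc mc nm.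
    by case/andP: mx; rewrite -e lee_fin leNgt xc.
  (* An infinite bound forces the source of the segment to be [+oo]; on reals the brackets there
     make no difference. *)
  have vE : vtx A (n + 1) = +oo%E by apply/eqP; rewrite -leye_eq -bE.
  apply: (@proj_pinfty _ _ _ (n + 1)) => //; rewrite ?addrK ?evenzD1 ?ev//.
  by apply/seteqP; split=> x; rewrite /trace /= !itv_boundlr /= !bnd_simp vE leey ltry.
- have precn x y : seg A n x -> seg A n y -> prec A x y <-> y <= x.
    by move=> sx sy; rewrite (precE hn hn1)// (negbTE ev).
  have [[a [Ja sa] amin]|nomin] := pselect (exists2 a, E a & forall y, E y -> a <= y).
    have y0a : a <= y0 by exact: amin.
    have [|K hK] := down_interval hn hn1 sa.
      by rewrite (negbTE ev) (le_lt_trans _ y0n)// lee_fin.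
    have KE x : x%:E \in K <-> exists y, [/\ y%:E \in J, seg A n y & prec A x y].
      rewrite hK; split=> [xa|[y [Jy sy xy]]]; first by exists a.
      by apply: prec_trans xy _; rewrite precn//; apply: amin.
    exists K => //; apply: (@proj_at _ _ _ a).
    by apply/seteqP; split=> x; rewrite /trace /= hK.
  have dn y : E y -> exists2 y', E y' & y' < y.
    move=> Ey; apply: contrapT => h; apply: nomin; exists y => // z Ez.
    by rewrite leNgt; apply/negP => yz; apply: h; exists z.
  pose b := ereal_inf (EFin @` E)%classic.
  have bn : (vtx A n <= b)%E.
    by apply: le_ereal_inf_tmp => _ [y [_ /andP[? _]] <-].
  have Eb y : E y -> (b < y%:E)%E.
    move=> /dn[y' Ey' yy']; apply: (@le_lt_trans _ _ y'%:E); last by rewrite lte_fin.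
    by apply: ereal_inf_lbound; exists y'.
  have KE x : (x%:E \in `]b, vtx A (n + 1)]) <->
      exists y, [/\ y%:E \in J, seg A n y & prec A x y].
    rewrite itv_boundlr /= !bnd_simp; split=> [/andP[xb xn]|[y [Jy sy xy]]].
      have [_ [y [Jy sy] <-]] := ereal_inf_lt xb.
      rewrite lte_fin => xy'; exists y; split=> //.
      rewrite precn ?(ltW xy')// /seg xn andbT.
      by case/andP: sy => ny _; apply: le_trans ny _; rewrite lee_fin ltW.
    have [y' [Jy' sy'] yy'] := dn y (conj Jy sy).
    have [y2 [_ /andP[ny2 _]] y'y2] := dn y' (conj Jy' sy').
    have y'n : (y'%:E < vtx A (n + 1))%E.
      by case/andP: sy => _; apply: lt_le_trans; rewrite lte_fin.
    have ny' : (vtx A n < y'%:E)%E by rewrite (le_lt_trans ny2)// lte_fin.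
    have : prec A x y'.
      by apply: prec_trans xy _; rewrite precn// ltW.
    rewrite (prec_interior _ hn hn1)// (negbTE ev) => -[/andP[_ ->] xy' /=].
    by rewrite andbT (lt_le_trans (Eb y' (conj Jy' sy')))// lee_fin.
  exists `]b, vtx A (n + 1)] => //.
  have y0b : (b < y0%:E)%E by apply: Eb.
  case bE : b y0b => [c|//|] y0b.
    have sc : seg A n c by rewrite /seg -bE bn bE (le_trans _ (ltW y0n))// ltW.
    apply: (@proj_right _ _ _ c); first by exists y0; rewrite /trace /= -bE KE; exists y0;
      split=> //; apply: (prec_refl hn hn1).
    apply/seteqP; split=> x; rewrite /trace /= itv_boundlr /= !bnd_simp.
      move=> /andP[]; rewrite lte_fin => cx xn; split=> //.
      rewrite precn ?(ltW cx)// /seg xn andbT; case/andP: sc => nc _.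
      by apply: le_trans nc _; rewrite lee_fin ltW.
    move=> [xc' cx]; rewrite lte_fin cx /=.
    have [m [hm hm1 mc mx]] := prec_seg xc'.
    have [mn|nm|<-] := ltgtP m n; last by case/andP: mx.
      have [nE e] := seg_vertex hm hm1 hn hn1 mc sc mn.
      by case/andP: mx => _; rewrite -nE -e lee_fin leNgt cx.
    have [mE e] := seg_vertex hn hn1 hm hm1 sc mc nm.
    by move: y0b; rewrite e mE ltNge (ltW y0n).
  have vE : vtx A n = -oo%E by apply/eqP; rewrite -leeNy_eq -bE.
  apply: (@proj_ninfty _ _ _ n) => //.
  by apply/seteqP; split=> x; rewrite /trace /= !itv_boundlr /= !bnd_simp vE leNye ltNyr.
Qed.

End DownClosures.

(** * Interval representations as quotients of finite sums of projectives *)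

Section InRep.
Context {R : realType} {k : fieldType} {A : cquiver R}.
Implicit Types (J K : interval (\bar R)).

Lemma Mint_pointwise_fd J : pointwise_fd (Mint k A J).
Proof.
move=> x; exists 1%N, (fun=> const_mx 1) => v; exists (fun=> entry v).
by rewrite big_ord1 entryK.
Qed.

Lemma rep_sum_pointwise_fd (V W : rep k A) :
  pointwise_fd V -> pointwise_fd W -> pointwise_fd (rep_sum V W).
Proof.
move=> hV hW x; have [n1 [e1 h1]] := hV x; have [n2 [e2 h2]] := hW x.
exists (n1 + n2)%N, (fun i => match fintype.split i with
  | inl i1 => (e1 i1, 0) | inr i2 => (0, e2 i2) end) => -[v w].
have [c1 v1] := h1 v; have [c2 w2] := h2 w.
exists (fun i => match fintype.split i with
  | inl i1 => c1 i1 | inr i2 => c2 i2 end).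
rewrite big_split_ord /=.
under eq_bigr do rewrite (unsplitK (inl _)).
under [X in _ + X]eq_bigr do rewrite (unsplitK (inr _)).
have sum1 n (c : 'I_n -> k) (e : 'I_n -> V x) :
    \sum_i c i *: ((e i, 0) : rep_sum V W x) = (\sum_i c i *: e i, 0).
  rewrite -[RHS]/(fam_inl V W x _) linear_sum; apply: eq_bigr => i _.
  by rewrite linearZ.
have sum2 n (c : 'I_n -> k) (e : 'I_n -> W x) :
    \sum_i c i *: ((0, e i) : rep_sum V W x) = (0, \sum_i c i *: e i).
  rewrite -[RHS]/(fam_inr V W x _) linear_sum; apply: eq_bigr => i _.
  by rewrite linearZ.
rewrite sum1 sum2 v1 w2.
by apply: injective_projections; rewrite /= ?addr0 ?add0r.
Qed.

Definition ones_fam J K : fam (Mint k A J) (Mint k A K) :=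
  fun x => ones k (x%:E \in J) (x%:E \in K).

(** For an arrow from [x] in [J] to [y] in [K], one way round the naturality square is nonzero
    exactly when [y] is in [J], the other exactly when [x] is in [K]. *)
Definition interval_compat J K : Prop :=
  forall x y : R, prec A y x -> x%:E \in J -> y%:E \in K ->
    (y%:E \in J) = (x%:E \in K).

Lemma ones_fam_natural J K : interval_compat J K -> natural (@ones_fam J K).
Proof.
move=> h x y yx v.
have [yK|yK] := orP (orbN (y%:E \in K)); last exact: Mint_out.
have [xJ|xJ] := orP (orbN (x%:E \in J)); last first.
  by rewrite (Mint_out v 0 xJ) !linear0.
have e := h x y yx xJ yK.
change (ones k (x%:E \in K) (y%:E \in K) (ones k (x%:E \in J) (x%:E \in K) v) =
  ones k (y%:E \in J) (y%:E \in K) (ones k (x%:E \in J) (y%:E \in J) v)).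
by rewrite [LHS]onesE [RHS]onesE !coord_ones e.
Qed.

Lemma rep_bigsum_cat (s1 s2 : seq (rep k A)) :
  exists (a : fam (rep_bigsum (s1 ++ s2)) (rep_bigsum s1))
         (b : fam (rep_bigsum (s1 ++ s2)) (rep_bigsum s2)),
    [/\ natural a, natural b
      & forall x u v, exists w, a x w = u /\ b x w = v].
Proof.
elim: s1 => [|V s1 [a [b [na nb hab]]]].
  exists (fun x => \0), (fun x => idfun); split=> [//|//|x u v] /=.
  by exists v; split=> //; rewrite [u]thinmx0.
exists (fam_pair (fam_fst V _) (fam_comp (fam_snd V (rep_bigsum (s1 ++ s2))) a)).
exists (fam_comp (fam_snd V (rep_bigsum (s1 ++ s2))) b); split.
- apply: fam_pair_natural => //.
  by apply: fam_comp_natural.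
- by apply: fam_comp_natural.
- move=> x [v u] w; have [z [az bz]] := hab x u w.
  by exists (v, z); split; rewrite //= az.
Qed.

Lemma in_repk_sum (V W : rep k A) :
  in_repk V -> in_repk W -> in_repk (rep_sum V W).
Proof.
move=> [fV [s1 [h1 [q1 [n1 k1]]]]] [fW [s2 [h2 [q2 [n2 k2]]]]].
split; first exact: rep_sum_pointwise_fd.
exists (s1 ++ s2); split.
  by move=> J; rewrite mem_cat => /orP[/h1|/h2].
have [a [b [na nb hab]]] :=
  rep_bigsum_cat [seq Mint k A J | J <- s1] [seq Mint k A J | J <- s2].
rewrite map_cat; exists (fam_pair (fam_comp a q1) (fam_comp b q2)); split.
  by apply: fam_pair_natural; apply: fam_comp_natural.
move=> x [v w]; have [u1 e1] := k1 x v; have [u2 e2] := k2 x w.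
have [u [ea eb]] := hab x u1 u2; exists u.
by rewrite /= ea eb e1 e2.
Qed.

Lemma in_repk_cover J (s : seq (interval (\bar R))) :
  (forall K, K \in s -> proj_support A K /\ interval_compat K J) ->
  (forall x : R, x%:E \in J -> exists2 K, K \in s & x%:E \in K) ->
  in_repk (Mint k A J).
Proof.
move=> hs cov; split; first exact: Mint_pointwise_fd.
exists s; split; first by move=> K /hs[].
suff [q [nq hq]] : exists q : fam (rep_bigsum [seq Mint k A K | K <- s]) (Mint k A J),
    natural q /\ forall K (x : R) v, K \in s -> x%:E \in K -> exists u, q x u = v.
  exists q; split=> // x v.
  have [xJ|xJ] := orP (orbN (x%:E \in J)).
    by have [K sK xK] := cov x xJ; apply: hq sK xK.
  by exists 0; apply: Mint_out.
elim: s hs {cov} => [|K s IH] hs.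
  by exists (fun x => \0); split=> // x y h v; apply: linear0.
have [|q [nq hq]] := IH; first by move=> L sL; apply: hs; rewrite inE sL orbT.
exists (fam_copair (@ones_fam K J) q); split.
  apply: fam_copair_natural => //; apply: ones_fam_natural.
  by have [] := hs K; rewrite ?mem_head.
move=> L x v; rewrite inE => /orP[/eqP->|sL] xL; last first.
  have [u e] := hq L x v sL xL; exists (0, u).
  by rewrite -[LHS]/(@ones_fam K J x 0 + q x u) linear0 add0r.
exists (entry v *: const_mx 1, 0).
rewrite -[LHS]/(@ones_fam K J x (entry v *: const_mx 1) + q x 0) linear0 addr0.
rewrite -[LHS]/(ones k (x%:E \in K) (x%:E \in J) (entry v *: const_mx 1)).
by rewrite onesE coordZ1_in// entryK.
Qed.

Lemma int_switch (P : int -> Prop) i j : i < j -> P i -> ~ P j ->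
  exists n, [/\ i <= n, n < j, P n & ~ P (n + 1)].
Proof.
move=> ij Pi Pj; have [n jE] : exists n : nat, j = i + n%:Z.
  by exists (absz (j - i)%R); lia.
subst j; elim: n {ij} Pj => [|n IH] Pj; first by rewrite addr0 in Pj.
have [Pn|Pn] := pselect (P (i + n%:Z)).
  exists (i + n%:Z); split=> //; [by lia | by lia |].
  by have -> : i + n%:Z + 1 = i + n.+1%:Z by lia.
by have [m [im mn Pm Pm1]] := IH Pn; exists m; split=> //; lia.
Qed.

(** Each segment whose interior meets [J] contributes the down-closure of its part of [J]. Having
    two points, [J] has no point away from all these segments, so the finitely many projectives
    cover it. *)
Lemma in_repk_interval J i j (c c' : R) :
  hasidx A i -> hasidx A j -> i < j ->
  (forall x : R, x%:E \in J -> (vtx A i <= x%:E)%E && (x%:E <= vtx A j)%E) ->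
  c%:E \in J -> c'%:E \in J -> c < c' -> in_repk (Mint k A J).
Proof.
move=> hi hj ij Jij cJ cJ' cc'.
have conv (x y z : R) : x <= y -> y <= z -> x%:E \in J -> z%:E \in J -> y%:E \in J.
  by move=> xy yz; apply: itv_conv; rewrite xy yz orbT.
have idx n : i <= n -> n < j -> hasidx A n /\ hasidx A (n + 1).
  by move=> ni nj; split; apply: (hasidx_mid hi hj); lia.
(* [y] is found beside [x], on the side of [c] or of [c'], before the next vertex. *)
have near (x : R) : x%:E \in J -> exists n (y : R),
    [/\ i <= n, n < j, seg A n x, y%:E \in J
      & (vtx A n < y%:E)%E && (y%:E < vtx A (n + 1))%E].
  move=> xJ; have /andP[ix xj] := Jij x xJ.
  have [cx|xc] := ltP c x.
    have [||n [ni nj nx xn]] := @int_switch (fun n => (vtx A n < x%:E)%E) i j ij.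
    - by have /andP[ic _] := Jij c cJ; rewrite (le_lt_trans ic)// lte_fin.
    - by apply/negP; rewrite -leNgt.
    move/negP: xn; rewrite -leNgt => xn.
    have [|y yx] := @ereal_between_right R x (maxe c%:E (vtx A n)).
      by rewrite gt_max lte_fin cx.
    rewrite gt_max lte_fin => /andP[cy ny].
    exists n, y; split=> //; first by rewrite /seg ltW.
      by apply: (conv c _ x); rewrite ?ltW.
    by rewrite ny (lt_le_trans _ xn)// lte_fin.
  have xc' := le_lt_trans xc cc'.
  have [||n [ni nj nx xn]] := @int_switch (fun n => (vtx A n <= x%:E)%E) i j ij.
  - by [].
  - apply/negP; rewrite -ltNge; have /andP[_ cj] := Jij c' cJ'.
    by rewrite (lt_le_trans _ cj)// lte_fin.
  move/negP: xn; rewrite -ltNge => xn.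
  have [|y yx] := @ereal_between R x (mine c'%:E (vtx A (n + 1))).
    by rewrite lt_min lte_fin xc'.
  rewrite lt_min lte_fin => /andP[cy ny].
  exists n, y; split=> //; first by rewrite /seg nx ltW.
    by apply: (conv x _ c'); rewrite ?ltW.
  by rewrite ny (le_lt_trans nx)// lte_fin.
have [s hs cov] : exists2 s : seq (interval (\bar R)),
    forall K, K \in s -> proj_support A K /\ interval_compat K J
  & forall n (x y : R), i <= n -> n < j -> seg A n x -> x%:E \in J ->
      y%:E \in J -> (vtx A n < y%:E)%E && (y%:E < vtx A (n + 1))%E ->
      exists2 K, K \in s & x%:E \in K.
  have [N jE] : exists N : nat, j = i + N%:Z by exists (absz (j - i)%R); lia.
  have sub (h : nat) : (h <= N)%N -> exists2 s : seq (interval (\bar R)),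
    forall K, K \in s -> proj_support A K /\ interval_compat K J
  & forall n (x y : R), i <= n -> n < i + h%:Z -> seg A n x -> x%:E \in J ->
      y%:E \in J -> (vtx A n < y%:E)%E && (y%:E < vtx A (n + 1))%E ->
      exists2 K, K \in s & x%:E \in K.
    elim: h => [_|h IH hN].
      by exists [::] => // n x y ni; rewrite addr0 ltNge ni.
    have [|s hs cov] := IH; first exact: ltnW.
    set m := i + h%:Z.
    have [hm hm1] : hasidx A m /\ hasidx A (m + 1) by apply: idx; rewrite /m; lia.
    have split_m n : n < i + h.+1%:Z -> n < m \/ n = m.
      by move=> ?; rewrite /m; lia.
    have [[y0 [Jy0 /andP[my0 y0m]]]|none] := pselect (exists y : R, y%:E \in J /\
        (vtx A m < y%:E)%E && (y%:E < vtx A (m + 1))%E); last first.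
      exists s => // n x y ni /split_m[nm|->]; first exact: cov.
      by move=> _ _ yJ hy; case: none; exists y.
    have [K Kp KE] := down_closure_projective hm hm1 Jy0 my0 y0m.
    exists (K :: s).
      move=> L; rewrite inE => /orP[/eqP->|/hs//]; split=> // x z zx.
      (* [K] is closed downwards, which puts [z] in it; [x] lies between [z] and [y], both in
         [J]. *)
      move=> /KE[y [yJ sy xy]] zJ.
      have -> : z%:E \in K by apply/KE; exists y; split=> //; apply: prec_trans xy.
      by symmetry; apply: (itv_conv (prec_between xy zx)).
    move=> n x y ni /split_m[nm|->] sx xJ yJ hy.
      have [L sL xL] := cov n x y ni nm sx xJ yJ hy.
      by exists L => //; rewrite inE sL orbT.
    exists K; first exact: mem_head.
    by apply/KE; exists x; split=> //; apply: (prec_refl hm hm1).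
  by have [s hs cov] := sub N (leqnn N); exists s; rewrite ?jE.
apply: (in_repk_cover hs) => x xJ.
have [n [y [ni nj sx yJ hy]]] := near x xJ.
exact: (cov n x y).
Qed.

End InRep.

(** * Exactness at one point *)

Section PointwiseExact.
Context {k : fieldType}.

Lemma coord_inj (b : bool) : injective (@coord k b).
Proof. by move=> v w e; rewrite -[v]coordK e coordK. Qed.

Lemma coordB (b : bool) (v w : 'rV[k]_b) : coord (v - w) = coord v - coord w.
Proof.
by rewrite addrC -scaleN1r coord_lin mulN1r addrC.
Qed.

(** The hypotheses say that as many of [b1], [b2] are true as of [bN], [bM]: a dimension count that
    leaves finitely many boolean cases. *)
Lemma ones_exact (bN b1 b2 bM : bool) :
  b1 && b2 = bN && bM -> b1 || b2 = bN || bM ->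
  [/\ injective (fun v : 'rV[k]_bN => (ones k bN b1 v, ones k bN b2 v)),
      forall u : 'rV[k]_b1 * 'rV[k]_b2,
        ones k b1 bM u.1 - ones k b2 bM u.2 = 0 <->
        exists v, (ones k bN b1 v, ones k bN b2 v) = u
    & forall w, exists u : 'rV[k]_b1 * 'rV[k]_b2,
        ones k b1 bM u.1 - ones k b2 bM u.2 = w].
Proof.
move=> hand hor; split.
- move=> v w [/(congr1 coord) + /(congr1 coord)]; rewrite !coord_ones => e1 e2.
  apply: coord_inj; move: (@coord_out k _ v) (@coord_out k _ w) e1 e2 hor.
  move: (coord v) (coord w) => x y; case: (bN); last by move=> /(_ isT)-> /(_ isT)->.
  by move=> _ _; case: (b1) (b2) => [] []; rewrite //= ?mul1r.
- move=> [u1 u2]; split=> /= [/(congr1 coord)|[v [<- <-]]].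
    rewrite coordB !coord_ones (coord_const 0) mulr0 => e.
    exists ((if b1 then coord u1 else coord u2) *: const_mx 1).
    congr (_, _); apply: coord_inj; rewrite coord_ones coordZ1;
      move: (@coord_out k _ u1) (@coord_out k _ u2) e hand hor;
      move: (coord u1) (coord u2) => x y;
      case: (bN); case: (b1); case: (b2); case: (bM);
      rewrite //= ?mul1r ?mul0r ?mulr0 => // h1 h2;
      try rewrite (h1 isT); try rewrite (h2 isT); rewrite ?subr0 ?sub0r//.
    all: try by move=> /eqP; rewrite ?oppr_eq0 ?subr_eq0 => /eqP->.
  apply: coord_inj; rewrite coordB !coord_ones (coord_const 0) mulr0.
  move: (@coord_out k _ v) hand hor; move: (coord v) => x.
  by case: (bN); case: (b1); case: (b2); case: (bM);
    rewrite //= ?mul1r ?mul0r ?subrr// => h; rewrite h// ?mulr0 ?subr0.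
(* The preimage sits in the first summand if that is nonzero, otherwise in the second with the
   opposite sign. *)
- move=> w; pose u1 : 'rV[k]_b1 := (b1%:R * coord w) *: const_mx 1.
  pose u2 : 'rV[k]_b2 := (- ((~~ b1)%:R * coord w)) *: const_mx 1.
  exists (u1, u2); apply: coord_inj; rewrite /= coordB !coord_ones !coordZ1.
  move: (@coord_out k _ w) hor; move: (coord w) => x; case: (b1); case: (b2); case: (bM); case: (bN);
  rewrite //= ?mul1r ?mul0r ?mulr0 ?subr0 ?sub0r ?opprK ?oppr0 ?addr0// => h hh;
  first [by [] | by rewrite h].
Qed.

End PointwiseExact.

(** * The almost split sequence attached to two ends *)

Section Assembly.
Context {R : realType} (k : fieldType) {A : cquiver R}.
Variables (l : \bar R) (p q : R) (r : \bar R) (d d' : bool) (m n : int).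
Hypotheses (lend : left_end A d l p m) (rend : right_end A d' r q n).
Hypothesis (pq : p < q).

Notation S := (supp l p q r).

(** Chosen to reduce literally to the intervals of [seq_type] once the booleans are known. *)
Definition itv_of (a b : bool) : interval (\bar R) :=
  Interval (if a then BLeft l else BRight p%:E)
           (if b then BRight r else BLeft q%:E).

Lemma mem_itv_of a b (x : R) : (x%:E \in itv_of a b) = S a b x.
Proof.
have lp := left_end_le lend; have qr := right_end_le rend.
rewrite /itv_of itv_boundlr /supp.
have [xp|px] := leP x p.
  have xq : x < q := le_lt_trans xp pq.
  have xr : (x%:E <= r)%E by rewrite (le_trans _ qr)// lee_fin ltW.
  rewrite (leNgt q) xq /= !andbT !andbF orbF.
  by case: a; case: b; rewrite /= !bnd_simp ?lte_fin ?xq ?xr ?andbT ?(ltNge p) ?xp.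
have lx : (l <= x%:E)%E by rewrite (le_trans lp)// lee_fin ltW.
rewrite andbF andbF /=.
have [xq|qx] := ltP x q.
  have xr : (x%:E <= r)%E by rewrite (le_trans _ qr)// lee_fin ltW.
  by case: a; case: b; rewrite /= !bnd_simp ?lte_fin ?xq ?xr ?lx ?px.
by case: a; case: b; rewrite /= !bnd_simp ?lte_fin ?lx ?px ?(ltNge x) ?qx //= ?andbF.
Qed.

(** An arrow from the block to a point past [e] factors through [e], and the end facts forbid arrows
    from the block into []p, e]]. *)
Lemma block_left u z : (l <= u%:E)%E && (u <= p) -> p < z ->
  ~ ordirect (prec A) d z u.
Proof.
move=> hu pz zu; have [e [f [pe ef fq em nf]]] := core_points lend rend pq.
have [_ _ _ _ h _ _] := left_endfacts lend pe em.
have up : u <= p by case/andP: hu.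
have [ze|ez] := leP z e; first by apply: (h u z) => //; rewrite pz.
apply: (h u e hu); first by rewrite pe lexx.
have b : (u <= e <= z) || (z <= e <= u).
  by rewrite (le_trans up (ltW pe)) ltW.
case: (d) zu => /= zu; last by have [] := prec_mid zu (c := e); rewrite // orbC.
by have [] := prec_mid zu (c := e).
Qed.

Lemma block_right u z : (q <= u) && (u%:E <= r)%E -> z < q ->
  ~ ordirect (prec A) d' z u.
Proof.
move=> hu zq zu; have [e [f [pe ef fq em nf]]] := core_points lend rend pq.
have [_ _ _ _ h _ _] := right_endfacts rend fq nf.
have qu : q <= u by case/andP: hu.
have [fz|zf] := leP f z; first by apply: (h u z) => //; rewrite zq fz.
apply: (h u f hu); first by rewrite fq lexx.
have b : (u <= f <= z) || (z <= f <= u).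
  by rewrite (ltW zf) (le_trans (ltW fq) qu) orbT.
case: (d') zu => /= zu; last by have [] := prec_mid zu (c := f); rewrite // orbC.
by have [] := prec_mid zu (c := f).
Qed.

Lemma supp_gt b x : S false b x -> p < x.
Proof.
move=> /orP[/andP[]//|/= /and3P[_ qx _]]; exact: lt_le_trans qx.
Qed.

Lemma supp_lt a x : S a false x -> x < q.
Proof.
rewrite /supp orbF => /orP[/andP[]//|/and3P[_ _ xp]]; exact: le_lt_trans pq.
Qed.

Lemma supp_left_split b x : S true b x ->
  S false b x \/ (l <= x%:E)%E && (x <= p).
Proof.
by rewrite /supp /= => /or3P[h|h|h]; [left; rewrite h|right|left; rewrite h orbT].
Qed.

Lemma supp_right_split a x : S a true x ->
  S a false x \/ (q <= x) && (x%:E <= r)%E.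
Proof.
by rewrite /supp /= orbF => /or3P[h|h|h]; [left; rewrite h|left; rewrite h orbT|right].
Qed.

Lemma supp_mono (a b a' b' : bool) x : (a -> a') -> (b -> b') ->
  S a b x -> S a' b' x.
Proof.
rewrite /supp => ha hb /or3P[->//|/andP[/ha-> ->]|/andP[/hb-> ->]].
  by rewrite orbT.
by rewrite !orbT.
Qed.

(** Only arrows between the left block and points right of [p] could break compatibility, and
    [block_left] excludes them in the relevant direction. *)
Lemma itv_compat_left b : @interval_compat R A (itv_of d b) (itv_of (~~ d) b).
Proof.
move=> x y yx; rewrite !mem_itv_of; case: (d) block_left => /= bl Sx Sy.
  rewrite (@supp_mono false b true b)//.
  have [->//|hx] := supp_left_split Sx.
  by case: (bl x y hx (supp_gt Sy)).
rewrite (@supp_mono false b true b _ _ _ Sx)//.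
have [->//|hy] := supp_left_split Sy.
by case: (bl y x hy (supp_gt Sx)).
Qed.

Lemma itv_compat_right a : @interval_compat R A (itv_of a d') (itv_of a (~~ d')).
Proof.
move=> x y yx; rewrite !mem_itv_of; case: (d') block_right => /= bl Sx Sy.
  rewrite (@supp_mono a false a true)//.
  have [->//|hx] := supp_right_split Sx.
  by case: (bl x y hx (supp_lt Sy)).
rewrite (@supp_mono a false a true _ _ _ Sx)//.
have [->//|hy] := supp_right_split Sy.
by case: (bl y x hy (supp_lt Sx)).
Qed.

Lemma itv_of_in_repk a b : in_repk (Mint k A (itv_of a b)).
Proof.
have [i [j [hi hj ij hS]]] := supp_range lend rend pq.
have [|e pe eq] := @ereal_between R p q%:E; first by rewrite lte_fin.
rewrite lte_fin in eq.
have [|e' pe' eq'] := @ereal_between R p e%:E; first by rewrite lte_fin.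
rewrite lte_fin in eq'.
apply: (@in_repk_interval _ _ _ _ i j e' e) => //.
- by move=> x; rewrite mem_itv_of => /hS.
- by rewrite mem_itv_of supp_mid// (lt_trans eq').
- by rewrite mem_itv_of supp_mid.
Qed.

Let PQ x : (l <= x%:E)%E && (x <= p) -> (q <= x) && (x%:E <= r)%E -> False.
Proof.
by move=> /andP[_ xp] /andP[qx _]; have := lt_le_trans pq (le_trans qx xp); rewrite ltxx.
Qed.

Lemma itv_of_AR : AR_sequence
  (@mono11 R k A (itv_of d d') (itv_of d (~~ d')) (itv_of (~~ d) d'))
  (@epi1N1 R k A (itv_of d (~~ d')) (itv_of (~~ d) d') (itv_of (~~ d) (~~ d'))).
Proof.
have mN := mem_itv_of d d'; have m1 := mem_itv_of d (~~ d').
have m2 := mem_itv_of (~~ d) d'; have mM := mem_itv_of (~~ d) (~~ d').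
split; first by split; [|apply: in_repk_sum|]; exact: itv_of_in_repk.
split.
  split.
  (* N -> I1 and I2 -> M change the right block, N -> I2 and I1 -> M the left one. *)
  - move=> x y h v.
    have e1 := ones_fam_natural (k := k) (@itv_compat_right d) h v.
    have e2 := ones_fam_natural (k := k) (@itv_compat_left d') h v.
    exact: (f_equal2 pair e1 e2).
  - move=> x y h [u v].
    have e1 := ones_fam_natural (k := k) (@itv_compat_left (~~ d')) h u.
    have e2 := ones_fam_natural (k := k) (@itv_compat_right (~~ d)) h v.
    apply: (etrans _ (f_equal2 (fun a b => a - b) e1 e2)).
    exact: linearB.
  - move=> x.
    have [||h1 h2 h3] := @ones_exact k (x%:E \in itv_of d d')
      (x%:E \in itv_of d (~~ d')) (x%:E \in itv_of (~~ d) d')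
      (x%:E \in itv_of (~~ d) (~~ d')).
    + rewrite mN m1 m2 mM /supp; move: (PQ (x := x)).
      by case: (p < x < q); case: ((l <= _)%E && _); case: ((q <= _) && _);
         case: (d); case: (d') => //= /(_ isT isT).
    + rewrite mN m1 m2 mM /supp.
      by case: (p < x < q); case: ((l <= _)%E && _); case: ((q <= _) && _);
         case: (d); case: (d').
    + by split.
split.
  split.
  - exact: (mono11_not_section lend rend pq mN m1 m2).
  - exact: (epi1N1_not_retraction lend rend pq m1 m2 mM).
  - exact: (supp_indecomposable lend rend pq mN).
  - exact: (supp_indecomposable lend rend pq mM).
split=> X h hX iX niso nh _.
- exact: (left_almost_split lend rend pq mN m1 m2).
- exact: (right_almost_split lend rend pq m1 m2 mM).
Qed.

End Assembly.

(** * The ends that occur in the 16 types *)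

Section EndsOfTypes.
Context {R : realType} (A : cquiver R).
Implicit Types (a b p q : R) (n : int).

Lemma left_end_point a s : surrounding_sink A a s ->
  ((s < a%:E)%E -> exists m, left_end A true a%:E a m) /\
  ((a%:E < s)%E -> exists m, left_end A false a%:E a m).
Proof.
move=> [m [hm hm1 ma am ->]]; case: ifPn => em; split=> h.
- by exists m; split=> //; [rewrite ltW | left].
- by move: (lt_trans ma h); rewrite ltxx.
- by move: (lt_trans am h); rewrite ltxx.
- by exists m; split=> //; [exact: negbTE | rewrite ltW | left].
Qed.

Lemma right_end_point b s : surrounding_sink A b s ->
  ((s < b%:E)%E -> exists n, right_end A false b%:E b n) /\
  ((b%:E < s)%E -> exists n, right_end A true b%:E b n).
Proof.
move=> [m [hm hm1 ma am ->]]; case: ifPn => em; split=> h.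
- by exists m; split=> //; [rewrite em | rewrite ma ltW | left].
- by move: (lt_trans ma h); rewrite ltxx.
- by move: (lt_trans am h); rewrite ltxx.
- by exists m; split=> //; [rewrite ma ltW | left].
Qed.

Lemma left_end_vertex n p : hasidx A n -> hasidx A (n + 1) ->
  vtx A (n + 1) = p%:E -> left_end A (evenz (n + 1)) (vtx A n) p (n + 1).
Proof.
move=> hn hn1 pE.
have hn2 : hasidx A (n + 1 + 1) by apply: (@next_idx _ _ _ +oo%E); rewrite ?pE ?ltry.
split=> //; first by rewrite -pE lexx vtx_ltn// ltrDl.
by right; split; rewrite ?addrK.
Qed.

(** The last segment of the core is [n - 1], of parity opposite to [n]; it exists because [q] is
    finite, hence not the first vertex. *)
Lemma right_end_vertex n q : hasidx A n -> hasidx A (n + 1) ->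
  vtx A n = q%:E -> right_end A (evenz n) (vtx A (n + 1)) q (n - 1).
Proof.
move=> hn hn1 qE.
have hn0 : hasidx A (n - 1) by apply: (@prev_idx _ _ _ -oo%E); rewrite ?qE ?ltNyr.
split; rewrite ?subrK//.
- by rewrite -evenzD1 subrK.
- by rewrite -qE lexx andbT vtx_ltn// ltrBlDr ltrDl.
- by right.
Qed.

Lemma vtx_fin n (a b : \bar R) : (a < vtx A n)%E -> (vtx A n < b)%E ->
  exists c : R, vtx A n = c%:E.
Proof.
by case: (vtx A n) => [c||]; [exists c | case: b | case: a].
Qed.

Lemma evenz2 n : evenz (2 * n).
Proof. by rewrite /evenz; lia. Qed.

Lemma evenz2D1 n : evenz (2 * n + 1) = false.
Proof. by rewrite /evenz; lia. Qed.

Lemma evenz2B1 n : evenz (2 * n - 1) = false.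
Proof. by rewrite /evenz; lia. Qed.

Lemma left_end_sink n (b : \bar R) : hasidx A (2 * n - 1) ->
  hasidx A (2 * n) -> (vtx A (2 * n) < b)%E ->
  exists p, vtx A (2 * n) = p%:E /\
    left_end A true (vtx A (2 * n - 1)) p (2 * n).
Proof.
move=> h1 h2 h.
have e : 2 * n = 2 * n - 1 + 1 by rewrite subrK.
have [p pE] : exists c : R, vtx A (2 * n) = c%:E.
  by apply: (@vtx_fin _ (vtx A (2 * n - 1)) b) => //; apply: vtx_ltn => //; lia.
exists p; split=> //.
have := @left_end_vertex (2 * n - 1) p h1; rewrite -e evenz2; exact.
Qed.

Lemma left_end_source n (b : \bar R) : hasidx A (2 * n) ->
  hasidx A (2 * n + 1) -> (vtx A (2 * n + 1) < b)%E ->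
  exists p, vtx A (2 * n + 1) = p%:E /\
    left_end A false (vtx A (2 * n)) p (2 * n + 1).
Proof.
move=> h1 h2 h.
have [p pE] : exists c : R, vtx A (2 * n + 1) = c%:E.
  by apply: (@vtx_fin _ (vtx A (2 * n)) b) => //; apply: vtx_ltn => //; lia.
exists p; split=> //.
by have := @left_end_vertex (2 * n) p h1; rewrite evenz2D1; exact.
Qed.

Lemma right_end_sink n (a : \bar R) : hasidx A (2 * n) ->
  hasidx A (2 * n + 1) -> (a < vtx A (2 * n))%E ->
  exists q, vtx A (2 * n) = q%:E /\
    right_end A true (vtx A (2 * n + 1)) q (2 * n - 1).
Proof.
move=> h1 h2 h.
have [q qE] : exists c : R, vtx A (2 * n) = c%:E.
  by apply: (@vtx_fin _ a (vtx A (2 * n + 1))) => //; apply: vtx_ltn => //; lia.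
exists q; split=> //.
by have := @right_end_vertex (2 * n) q h1; rewrite evenz2; exact.
Qed.

Lemma right_end_source n (a : \bar R) : hasidx A (2 * n - 1) ->
  hasidx A (2 * n) -> (a < vtx A (2 * n - 1))%E ->
  exists q, vtx A (2 * n - 1) = q%:E /\
    right_end A false (vtx A (2 * n)) q (2 * n - 1 - 1).
Proof.
move=> h1 h2 h.
have e : 2 * n = 2 * n - 1 + 1 by rewrite subrK.
have [q qE] : exists c : R, vtx A (2 * n - 1) = c%:E.
  by apply: (@vtx_fin _ a (vtx A (2 * n))) => //; apply: vtx_ltn => //; lia.
exists q; split=> //.
have := @right_end_vertex (2 * n - 1) q h1; rewrite -e evenz2B1; exact.
Qed.

End EndsOfTypes.

Theorem lemma3p1p2 (R : realType) (k : fieldType) (A : cquiver R)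
    (N I1 I2 M : interval (\bar R)) :
  seq_type A N I1 I2 M ->
  AR_sequence (@mono11 R k A N I1 I2) (@epi1N1 R k A I1 I2 M).
Proof.
(* In each case below, the two booleans tell whether N contains the left and the right block. *)
have fin : forall (d d' : bool) l p q r m n, left_end A d l p m ->
    right_end A d' r q n -> p < q ->
    AR_sequence
      (@mono11 R k A (itv_of l p q r d d') (itv_of l p q r d (~~ d')) (itv_of l p q r (~~ d) d'))
      (@epi1N1 R k A (itv_of l p q r d (~~ d')) (itv_of l p q r (~~ d) d')
        (itv_of l p q r (~~ d) (~~ d'))).
  by move=> d d' l p q r m n lend rend pq; apply: (itv_of_AR k lend rend pq).
case=> {N I1 I2 M}.
- move=> a b sa sb ab _ _ /left_end_point[/[swap] _ la] /right_end_point[/[swap] _ lb].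
  by move=> /la[m hm] /lb[n hn]; apply: (fin true false _ _ _ _ _ _ hm hn).
- move=> a b sa sb ab _ _ /left_end_point[/[swap] _ la] /right_end_point[_ lb].
  by move=> /la[m hm] /lb[n hn]; apply: (fin true true _ _ _ _ _ _ hm hn).
- move=> a b sa sb ab _ _ /left_end_point[_ la] /right_end_point[/[swap] _ lb].
  by move=> /la[m hm] /lb[n hn]; apply: (fin false false _ _ _ _ _ _ hm hn).
- move=> a b sa sb ab _ _ /left_end_point[_ la] /right_end_point[_ lb].
  by move=> /la[m hm] /lb[n hn]; apply: (fin false true _ _ _ _ _ _ hm hn).
- move=> i b sb h1 h2 /andP[_ ib] _ /right_end_point[/[swap] _ lb] /lb[n hn].
  have [p [pE hp]] := left_end_sink h1 h2 ib; rewrite pE in ib *.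
  by apply: (fin true false _ _ _ _ _ _ hp hn).
- move=> i b sb h1 h2 /andP[_ ib] _ /right_end_point[_ lb] /lb[n hn].
  have [p [pE hp]] := left_end_sink h1 h2 ib; rewrite pE in ib *.
  by apply: (fin true true _ _ _ _ _ _ hp hn).
- move=> i b sb h1 h2 /andP[_ ib] _ /right_end_point[/[swap] _ lb] /lb[n hn].
  have [p [pE hp]] := left_end_source h1 h2 ib; rewrite pE in ib *.
  by apply: (fin false false _ _ _ _ _ _ hp hn).
- move=> i b sb h1 h2 /andP[_ ib] _ /right_end_point[_ lb] /lb[n hn].
  have [p [pE hp]] := left_end_source h1 h2 ib; rewrite pE in ib *.
  by apply: (fin false true _ _ _ _ _ _ hp hn).
- move=> i a sa h1 h2 /andP[ai _] _ /left_end_point[/[swap] _ la] /la[m hm].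
  have [q [qE hq]] := right_end_sink h1 h2 ai; rewrite qE in ai *.
  by apply: (fin true true _ _ _ _ _ _ hm hq).
- move=> i a sa h1 h2 /andP[ai _] _ /left_end_point[_ la] /la[m hm].
  have [q [qE hq]] := right_end_sink h1 h2 ai; rewrite qE in ai *.
  by apply: (fin false true _ _ _ _ _ _ hm hq).
- move=> i a sa h1 h2 /andP[ai _] _ /left_end_point[/[swap] _ la] /la[m hm].
  have [q [qE hq]] := right_end_source h1 h2 ai; rewrite qE in ai *.
  by apply: (fin true false _ _ _ _ _ _ hm hq).
- move=> i a sa h1 h2 /andP[ai _] _ /left_end_point[_ la] /la[m hm].
  have [q [qE hq]] := right_end_source h1 h2 ai; rewrite qE in ai *.
  by apply: (fin false false _ _ _ _ _ _ hm hq).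
- move=> i j h1 h2 h3 h4 _ h _.
  have [p [pE hp]] := left_end_source h1 h2 h.
  have [q [qE hq]] := right_end_sink h3 h4 h; rewrite pE qE in h *.
  by apply: (fin false true _ _ _ _ _ _ hp hq).
- move=> i j h1 h2 h3 h4 _ h _.
  have [p [pE hp]] := left_end_sink h1 h2 h.
  have [q [qE hq]] := right_end_sink h3 h4 h; rewrite pE qE in h *.
  by apply: (fin true true _ _ _ _ _ _ hp hq).
- move=> i j h1 h2 h3 h4 _ h _.
  have [p [pE hp]] := left_end_source h1 h2 h.
  have [q [qE hq]] := right_end_source h3 h4 h; rewrite pE qE in h *.
  by apply: (fin false false _ _ _ _ _ _ hp hq).
- move=> i j h1 h2 h3 h4 _ h _.
  have [p [pE hp]] := left_end_sink h1 h2 h.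
  have [q [qE hq]] := right_end_source h3 h4 h; rewrite pE qE in h *.
  by apply: (fin true false _ _ _ _ _ _ hp hq).
Qed.
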